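(* Let $d \geq 3$. The Aperiodic Domino problem for $\mathbb{Z}^d$ sofic subshifts — given as input a $\mathbb{Z}^d$ sofic subshift $X$ (described by a finite set of forbidden patterns defining an SFT $X'$ together with a letter-to-letter projection $\pi$ with $X=\pi(X')$), decide whether $X$ contains an aperiodic configuration — is $\Sigma_1^1$-complete (under many-one reductions).
   Context: Let $\Sigma$ be a finite alphabet. A configuration is a map $c:\mathbb{Z}^d\to\Sigma$; a pattern is a map $w:D\to\Sigma$ with $D\subseteq\mathbb{Z}^d$ finite; $w$ appears in $x$ if there is $i$ with $x_{i+j}=w_j$ for all $j\in D$. For a family $\mathcal{F}$ of patterns, $X_{\mathcal{F}}$ is the set of configurations in which no pattern of $\mathcal{F}$ appears; such sets are subshifts. A subshift is of finite type (SFT) if it is $X_{\mathcal{F}}$ for a finite $\mathcal{F}$; it is sofic if it is the image of an SFT (on some alphabet $\Sigma'$) under a letter-to-letter projection $\pi:\Sigma'\to\Sigma$ applied cellwise. A vector $p\in\mathbb{Z}^d$ is broken in $x$ if $x_{i+p}\neq x_i$ for some $i$; $x$ is aperiodic if every nonzero vector $p\in\mathbb{Z}^d$ is broken in $x$. A decision problem $P$ on $\mathbb{N}$ is $\Sigma_1^1$ if there is an arithmetical relation $R$ with $P(n)=1 \iff \exists f\in 2^{\mathbb{N}}, R^f(n)$ ($R$ relativized to oracle $f$); it is $\Sigma_1^1$-complete if it is $\Sigma_1^1$ and every $\Sigma_1^1$ problem many-one reduces to it. *)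

(* Defs.v *)
From HB Require Import structures.
From mathcomp Require Import all_boot all_order all_algebra.

Set Implicit Arguments.
Unset Strict Implicit.
Unset Printing Implicit Defensive.

Import GRing.Theory.

(** * Computability on natural numbers *)

(* General recursive functions: minimization is applied only to regular
   functions, so the class consists of total functions.  Each clause specifies
   [f] pointwise, which makes the class closed under extensional equality. *)
Inductive recursive : forall k : nat, (k.-tuple nat -> nat) -> Prop :=
| recursive_zero k (f : k.-tuple nat -> nat) :
    (forall v, f v = 0) -> recursive f
| recursive_succ (f : 1.-tuple nat -> nat) :
    (forall v, f v = (thead v).+1) -> recursive f
| recursive_proj k (i : 'I_k) (f : k.-tuple nat -> nat) :
    (forall v, f v = tnth v i) -> recursive f
| recursive_comp k m (g : m.-tuple nat -> nat)
    (h : 'I_m -> k.-tuple nat -> nat) (f : k.-tuple nat -> nat) :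
    recursive g -> (forall i, recursive (h i)) ->
    (forall v, f v = g [tuple h i v | i < m]) -> recursive f
| recursive_prec k (g : k.-tuple nat -> nat) (h : k.+2.-tuple nat -> nat)
    (f : k.+1.-tuple nat -> nat) :
    recursive g -> recursive h ->
    (forall v : k.-tuple nat, f [tuple of 0 :: v] = g v) ->
    (forall n (v : k.-tuple nat),
       f [tuple of n.+1 :: v] = h [tuple of n :: f [tuple of n :: v] :: v]) ->
    recursive f
| recursive_min k (g : k.+1.-tuple nat -> nat) (f : k.-tuple nat -> nat) :
    recursive g ->
    (forall v : k.-tuple nat, g [tuple of f v :: v] = 0) ->
    (forall (v : k.-tuple nat) n, n < f v -> g [tuple of n :: v] <> 0) ->
    recursive f.

Definition computable (f : nat -> nat) : Prop :=
  recursive (fun v : 1.-tuple nat => f (thead v)).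

Definition many_one_reducible (P Q : nat -> Prop) : Prop :=
  exists2 r : nat -> nat, computable r & forall n, P n <-> Q (r n).

(** * Arithmetical relations with an oracle *)

(* First-order arithmetic extended by one unary predicate symbol [Oracle];
   variables are de Bruijn indices. *)
Inductive term : Type :=
| Var of nat
| Zero
| Succ of term
| Add of term & term
| Mul of term & term.

Inductive formula : Type :=
| Eq of term & term
| Oracle of term
| Not of formula
| And of formula & formula
| Or of formula & formula
| All of formula
| Ex of formula.

(* Variables beyond the length of the environment [e] denote 0. *)
Fixpoint eval (e : seq nat) (t : term) : nat :=
  match t with
  | Var i => nth 0 e i
  | Zero => 0
  | Succ t1 => (eval e t1).+1
  | Add t1 t2 => eval e t1 + eval e t2
  | Mul t1 t2 => eval e t1 * eval e t2
  end.

Fixpoint holds (f : nat -> bool) (e : seq nat) (phi : formula) : Prop :=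
  match phi with
  | Eq t1 t2 => eval e t1 = eval e t2
  | Oracle t => f (eval e t)
  | Not phi1 => ~ holds f e phi1
  | And phi1 phi2 => holds f e phi1 /\ holds f e phi2
  | Or phi1 phi2 => holds f e phi1 \/ holds f e phi2
  | All phi1 => forall n : nat, holds f (n :: e) phi1
  | Ex phi1 => exists n : nat, holds f (n :: e) phi1
  end.

(* [R f n] is the relation R relativized to the oracle f; the defining formula
   is the same for all oracles. *)
Definition arithmetical (R : (nat -> bool) -> nat -> Prop) : Prop :=
  exists phi : formula, forall f n, R f n <-> holds f [:: n] phi.

Definition Sigma11 (P : nat -> Prop) : Prop :=
  exists2 R : (nat -> bool) -> nat -> Prop,
    arithmetical R & forall n, P n <-> exists f : nat -> bool, R f n.

Definition Sigma11_complete (P : nat -> Prop) : Prop :=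
  Sigma11 P /\ forall Q : nat -> Prop, Sigma11 Q -> many_one_reducible Q P.

(* A problem on a countable type of inputs, read on [nat] through the library's
   Goedel numbering [pickle]; numbers that code no input are negative
   instances. *)
Definition coded_problem (T : countType) (P : T -> Prop) (n : nat) : Prop :=
  exists2 x : T, pickle x = n & P x.

(** * Configurations, patterns and subshifts *)

Definition configuration (d : nat) (S : finType) : Type := 'rV[int]_d -> S.

(* A map from a finite subset of Z^d to S, given by its graph: a list of
   (position, letter) pairs in which no position is repeated. *)
Record pattern (d : nat) (S : finType) : Type := Pattern {
  graph : seq ('rV[int]_d * S);
  graph_functional : uniq (unzip1 graph)
}.

HB.instance Definition _ (d : nat) (S : finType) := [isSub for @graph d S].
HB.instance Definition _ (d : nat) (S : finType) :=
  [Countable of pattern d S by <:].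

Section Subshifts.
Context {d : nat} {S : finType}.
Local Open Scope ring_scope.

Definition appears (w : pattern d S) (x : configuration d S) : Prop :=
  exists i : 'rV[int]_d,
    forall (j : 'rV[int]_d) (a : S), (j, a) \in graph w -> x (i + j) = a.

Definition subshift (F : pattern d S -> Prop) (x : configuration d S) : Prop :=
  forall w : pattern d S, F w -> ~ appears w x.

Definition broken (p : 'rV[int]_d) (x : configuration d S) : Prop :=
  exists i : 'rV[int]_d, x (i + p) <> x i.

Definition aperiodic (x : configuration d S) : Prop :=
  forall p : 'rV[int]_d, p <> 0 -> broken p x.

End Subshifts.

Definition SFT (d : nat) (S : finType) (F : seq (pattern d S)) :
    configuration d S -> Prop :=
  subshift (fun w => w \in F).

Definition projection (d : nat) (S' S : finType) (pi : S' -> S)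
    (X : configuration d S' -> Prop) (x : configuration d S) : Prop :=
  exists2 y : configuration d S', X y & forall i, x i = pi (y i).

(** * The aperiodic domino problem for sofic subshifts *)

(* The alphabets Sigma' and Sigma are given by their sizes. *)
Record sofic_input (d : nat) : Type := SoficInput {
  size_src : nat;
  size_tgt : nat;
  letter_map : {ffun 'I_size_src -> 'I_size_tgt};
  forbidden : seq (pattern d 'I_size_src)
}.

Section SoficInputCountable.
Variable d : nat.

Definition tag_of_sofic_input (X : sofic_input d) :
    {k : nat * nat &
      ({ffun 'I_k.1 -> 'I_k.2} * seq (pattern d 'I_k.1))%type} :=
  @Tagged _ (size_src X, size_tgt X)
    (fun k => ({ffun 'I_k.1 -> 'I_k.2} * seq (pattern d 'I_k.1))%type)
    (letter_map X, forbidden X).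

Definition sofic_input_of_tag
    (u : {k : nat * nat &
           ({ffun 'I_k.1 -> 'I_k.2} * seq (pattern d 'I_k.1))%type}) :
    sofic_input d :=
  SoficInput (tagged u).1 (tagged u).2.

Lemma tag_of_sofic_inputK : cancel tag_of_sofic_input sofic_input_of_tag.
Proof. by case. Qed.

HB.instance Definition _ :=
  Countable.copy (sofic_input d) (can_type tag_of_sofic_inputK).

End SoficInputCountable.

Definition sofic_subshift (d : nat) (X : sofic_input d) :
    configuration d 'I_(size_tgt X) -> Prop :=
  projection (letter_map X) (SFT (forbidden X)).

Definition has_aperiodic_configuration (d : nat) (X : sofic_input d) : Prop :=
  exists2 x : configuration d 'I_(size_tgt X),
    sofic_subshift x & aperiodic x.

(* All the codings involved (natural numbers, integers, pairs, lists, finite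
   functions given by their graphs) are the library's explicit ones, hence
   effective. *)
Definition aperiodic_domino (d : nat) : nat -> Prop :=
  coded_problem (@has_aperiodic_configuration d).

(* Main.v *)
(* Hardness.  A Sigma^1_1 set is put in the form { n | exists G, forall k,
   chi(n, k, G) } with chi existential, and the search for a proof of chi(n, k, G)
   for k = 0, 1, 2, ... is run by a nondeterministic register program.  Time is
   coordinate 0 of Z^d.  The value v of a register is a coset of 2^v Z along
   coordinate 1: incrementing it means erasing every other point, a local
   operation, and zero is all of Z, so that every column is periodic.  Two clocks,
   incremented at every step, are cosets along coordinates 1 and 2; the first one
   is contained in all the register cosets, so that these have coherent positions
   and the oracle G can be stored along coordinate 1 (G v is read on the coset of
   v minus that of v + 1).  Each proof of chi(n, k, G) is followed by a mark,
   which makes one of the two clocks visible in its column.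

   After an initial column, infinitely many marks of both kinds break all vectors
   in the plane of coordinates 1 and 2, whereas finitely many marks of the second
   kind leave a period 2^N along coordinate 2.  Vectors outside this plane are
   broken for free by a visible bit which only has to be constant along it.
   Without an initial column a clock coset has at most one point; since between two
   marks the points of the clock coset must flood the whole line at unit speed,
   there is at most one mark, and then a period along coordinate 1 or 2.

   Membership.  The second-order witness encodes, besides the configuration, the
   graphs of the functions that decode the input. *)

From HB Require Import structures.
Require Import Defs.
From mathcomp Require Import all_boot all_order all_algebra.
From mathcomp Require Import zify.
From Stdlib Require Import Classical ClassicalEpsilon.
From Stdlib Require Import FunctionalExtensionality PropExtensionality.

Set Implicit Arguments.
Unset Strict Implicit.
Unset Printing Implicit Defensive.

(** * Definability *)

(** Whether a nondeterministic computation meets marks infinitely often is a Sigma^1_1 question, but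
    local rules cannot require it; aperiodicity does. One mark shows a set of period 2^k, so only
    marks at unboundedly many times break all vectors, and the projection has to hide the clocks
    elsewhere. Local rules cannot force an initial column either: shifts of a tiling along time have
    limits without one, where the computation never started and proves nothing. The flood is
    directed against these: after an initial column finitely many idle steps suffice before a mark,
    whereas a clock that has doubled forever has gaps that never close. Register cosets are
    determined only up to translation. This is harmless when two values are compared, but equal
    values must read the oracle on the same cells at all times; hence the containment of the clock
    coset. In the normal form, G contains a truth table of all subformulas, so that k, which codes
    an environment, is the only universally quantified number. The input n enters neither the
    alphabet nor the local rules, only the length n + 1 of one far constraint; this keeps the
    reduction elementary. *)

Fixpoint existential (phi : formula) : bool :=
  match phi with
  | Eq _ _ | Oracle _ | Not (Oracle _) => true
  | And p q | Or p q => existential p && existential q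
  | Ex p => existential p
  | _ => false
  end.

(** The flag [b] asks for an existential formula, so that the same closure lemmas serve the normal
    form, with [b] true, and the upper bound, where all first-order formulas are allowed. *)
Definition definable (b : bool) (R : (nat -> bool) -> seq nat -> Prop) : Prop :=
  exists2 phi, b ==> existential phi & forall f e, holds f e phi <-> R f e.

Definition term_definable (T : seq nat -> nat) : Prop :=
  exists t, forall e, eval e t = T e.

Fixpoint lift (t : term) : term :=
  match t with
  | Var i => Var i.+1
  | Zero => Zero
  | Succ u => Succ (lift u)
  | Add u v => Add (lift u) (lift v)
  | Mul u v => Mul (lift u) (lift v)
  end.

Section Definable.
Variable b : bool.
Implicit Types (R : (nat -> bool) -> seq nat -> Prop) (T : seq nat -> nat).

Lemma term_var k : term_definable (fun e => head 0 (iter k behead e)).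
Proof.
exists (Var k) => e /=; rewrite -nth0.
by elim: k e => [|k IHk] e //; rewrite iterSr -IHk nth_behead.
Qed.

Lemma term_behead T :
  term_definable T -> term_definable (fun e => T (behead e)).
Proof.
case=> t tE; exists (lift t) => e; rewrite -tE.
by elim: t {tE} => //= [i|t ->|t -> u ->|t -> u ->] //; rewrite nth_behead.
Qed.

Lemma term_beheads k T :
  term_definable T -> term_definable (fun e => T (iter k behead e)).
Proof.
move=> defT; elim: k => // k /term_behead[t tE].
by exists t => e; rewrite tE -iterSr.
Qed.

Lemma term_const n : term_definable (fun=> n).
Proof. by exists (iter n Succ Zero) => e; elim: n => //= n ->. Qed.

Lemma term_succ T : term_definable T -> term_definable (fun e => (T e).+1).
Proof. by case=> t tE; exists (Succ t) => e /=; rewrite tE. Qed.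

Lemma term_add T1 T2 : term_definable T1 -> term_definable T2 ->
  term_definable (fun e => T1 e + T2 e).
Proof. by case=> t tE [u uE]; exists (Add t u) => e /=; rewrite tE uE. Qed.

Lemma term_mul T1 T2 : term_definable T1 -> term_definable T2 ->
  term_definable (fun e => T1 e * T2 e).
Proof. by case=> t tE [u uE]; exists (Mul t u) => e /=; rewrite tE uE. Qed.

Lemma definable_ext R R' :
  definable b R -> (forall f e, R f e <-> R' f e) -> definable b R'.
Proof.
by move=> [phi sphi phiE] RE; exists phi => // f e; rewrite -RE phiE.
Qed.

Lemma definable_and R1 R2 : definable b R1 -> definable b R2 ->
  definable b (fun f e => R1 f e /\ R2 f e).
Proof.
move=> [p sp pE] [q sq qE]; exists (And p q) => [|f e /=]; last by rewrite pE qE.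
by case: b sp sq => //= -> ->.
Qed.

Lemma definable_or R1 R2 : definable b R1 -> definable b R2 ->
  definable b (fun f e => R1 f e \/ R2 f e).
Proof.
move=> [p sp pE] [q sq qE]; exists (Or p q) => [|f e /=]; last by rewrite pE qE.
by case: b sp sq => //= -> ->.
Qed.

Lemma definable_ex (R : (nat -> bool) -> nat -> seq nat -> Prop) :
  definable b (fun f e => R f (head 0 e) (behead e)) ->
  definable b (fun f e => exists n, R f n e).
Proof.
move=> [p sp pE]; exists (Ex p) => // f e /=.
by split=> -[n pn]; exists n; apply/(pE _ (n :: e)).
Qed.

Lemma definable_eq T1 T2 : term_definable T1 -> term_definable T2 ->
  definable b (fun=> fun e => T1 e = T2 e).
Proof.
move=> [t tE] [u uE]; exists (Eq t u) => [|f e /=]; first by case: b.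
by rewrite tE uE.
Qed.

Lemma definable_oracle T : term_definable T -> definable b (fun f e => f (T e)).
Proof.
move=> [t tE]; exists (Oracle t) => [|f e /=]; first by case: b.
by rewrite tE.
Qed.

Lemma definable_noracle T : term_definable T ->
  definable b (fun f e => ~~ f (T e)).
Proof.
move=> [t tE]; exists (Not (Oracle t)) => [|f e /=]; first by case: b.
by rewrite tE; split => /negP.
Qed.

Lemma definable_lt T1 T2 : term_definable T1 -> term_definable T2 ->
  definable b (fun=> fun e => T1 e < T2 e).
Proof.
move=> /term_behead def1 /term_behead def2.
apply: (@definable_ext (fun=> fun e => exists k, T1 e + k.+1 = T2 e)).
  apply: (definable_ex (R := fun=> fun k e => T1 e + k.+1 = T2 e)).
  apply: definable_eq => //; apply: term_add => //.
  by apply: term_succ; exact: (term_var 0).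
move=> _ e; split=> [[k <-]|lt12]; first by lia.
by exists (T2 e - (T1 e).+1); lia.
Qed.

(** Two strict inequalities keep the formula existential, which a negated equation would not. *)
Lemma definable_neq T1 T2 : term_definable T1 -> term_definable T2 ->
  definable b (fun=> fun e => T1 e <> T2 e).
Proof.
move=> def1 def2.
apply: (@definable_ext (fun=> fun e => T1 e < T2 e \/ T2 e < T1 e)).
  by apply: definable_or; exact: definable_lt.
by move=> _ e; lia.
Qed.

End Definable.

Section ArithmeticalConnectives.
Implicit Types R : (nat -> bool) -> seq nat -> Prop.

Lemma definable_all (R : (nat -> bool) -> nat -> seq nat -> Prop) :
  definable false (fun f e => R f (head 0 e) (behead e)) ->
  definable false (fun f e => forall n, R f n e).
Proof.
move=> [p _ pE]; exists (All p) => // f e /=.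
by split=> pn n; apply/(pE _ (n :: e)).
Qed.

Lemma definable_imp R1 R2 : definable false R1 -> definable false R2 ->
  definable false (fun f e => R1 f e -> R2 f e).
Proof.
move=> [p _ pE] [q _ qE]; exists (Or (Not p) q) => // f e /=; rewrite pE qE.
by case: (classic (R1 f e)); tauto.
Qed.

Lemma definable_iff R1 R2 : definable false R1 -> definable false R2 ->
  definable false (fun f e => R1 f e <-> R2 f e).
Proof. by move=> d1 d2; apply: definable_and; apply: definable_imp. Qed.

Lemma definable_not R : definable false R -> definable false (fun f e => ~ R f e).
Proof. by move=> [p _ pE]; exists (Not p) => // f e /=; rewrite pE. Qed.

End ArithmeticalConnectives.

Create HintDb definable.

Ltac define_term :=
  cbv beta;
  lazymatch goal with
  | |- term_definable (fun e => head 0 (@?l e)) =>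
    first
    [ exact: (term_var 0) | exact: (term_var 1) | exact: (term_var 2)
    | exact: (term_var 3) | exact: (term_var 4) | exact: (term_var 5)
    | exact: (term_var 6) | exact: (term_var 7) | exact: (term_var 8)
    | exact: (term_var 9) | exact: (term_var 10) | exact: (term_var 11)
    | exact: (term_var 12) | exact: (term_var 13) | exact: (term_var 14)
    | exact: (term_var 15) | exact: (term_var 16) ]
  | |- term_definable (fun e => (@?t e).+1) => apply: term_succ; define_term
  | |- term_definable (fun e => @?t e + @?u e) => apply: term_add; define_term
  | |- term_definable (fun e => @?t e * @?u e) => apply: term_mul; define_term
  | |- _ =>
    first
    [ exact: term_const
    | exact: (term_var 0)
    | match goal with def : term_definable _ |- _ =>
        first [ exact: def | exact: (term_beheads 1 def)
              | exact: (term_beheads 2 def) | exact: (term_beheads 3 def)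
              | exact: (term_beheads 4 def) | exact: (term_beheads 5 def)
              | exact: (term_beheads 6 def) ]
      end ]
  end.

Ltac define :=
  cbv beta;
  lazymatch goal with
  | |- definable _ (fun f e => exists n, @?R f e n) => apply: definable_ex; define
  | |- definable _ (fun f e => forall n : nat, @?R f e n) => apply: definable_all; define
  | |- definable _ (fun f e => @?R f e <-> @?R' f e) => apply: definable_iff; define
  | |- definable _ (fun f e => @?R f e /\ @?R' f e) => apply: definable_and; define
  | |- definable _ (fun f e => @?R f e \/ @?R' f e) => apply: definable_or; define
  | |- definable _ (fun f e => @eq _ (@?t f e) (@?u f e)) =>
    apply: definable_eq; define_term
  | |- _ =>
    first
    [ apply: definable_neq; define_term
    | apply: definable_lt; define_term
    | apply: definable_oracle; define_term
    | apply: definable_noracle; define_term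
    | solve [auto 1 with definable nocore]
    | apply: definable_not; define
    | apply: definable_imp; define ]
  end.

Definition to_bool (P : Prop) : bool :=
  if excluded_middle_informative P then true else false.

Lemma to_boolP (P : Prop) : reflect P (to_bool P).
Proof. by rewrite /to_bool; case: excluded_middle_informative => H; constructor. Qed.

(** * A normal form for analytic sets *)

(** A polynomial, hence a term: the oracle is addressed at a pair without any quantifier. With s = x
    + y the value lies between s^2 and (s + 1)^2 - 1, so it determines s and then x. *)
Definition pr (x y : nat) : nat := (x + y) * (x + y) + x.

Lemma pr_inj x y x' y' : pr x y = pr x' y' -> x = x' /\ y = y'.
Proof.
rewrite /pr => prE.
have [||] := ltngtP (x + y) (x' + y'); [nia|nia|lia].
Qed.

Definition cantor (x y : nat) : nat := ((x + y) * (x + y).+1)./2 + y.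

(** Cantor's pairing is onto, so that every number codes an environment. Doubling its equation
    removes the division and leaves an equation between terms. *)
Definition pairs (c x y : nat) : Prop := c + c = (x + y) * (x + y).+1 + (y + y).

Lemma pairsP c x y : pairs c x y <-> c = cantor x y.
Proof.
rewrite /pairs /cantor; have := odd_double_half ((x + y) * (x + y).+1).
by rewrite oddM /= andbN; lia.
Qed.

Lemma pairs_inj c x y x' y' : pairs c x y -> pairs c x' y' -> x = x' /\ y = y'.
Proof.
rewrite /pairs => -> E.
have [||] := ltngtP (x + y) (x' + y'); [nia|nia|lia].
Qed.

Lemma pairs_surj c : exists x y, pairs c x y.
Proof.
rewrite /pairs; elim: c => [|c [[|x] [y cE]]]; first by exists 0, 0.
  by exists y.+1, 0; nia.
by exists x, y.+1; nia.
Qed.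

Lemma pairs_lt c x y : pairs c x y -> 0 < c -> y < c.
Proof. by rewrite /pairs; case: y => [|y] // cE _; nia. Qed.

(* An environment is coded as a right-nested Cantor pairing ending in 0, which
   also codes (0, 0): padding with zeros does not change the code. *)
Fixpoint codes (c : nat) (e : seq nat) : Prop :=
  if e is x :: e' then exists2 c', pairs c x c' & codes c' e' else c = 0.

Lemma codes_surj c : exists e, codes c e.
Proof.
elim/ltn_ind: c => -[|c] IHc; first by exists [::].
have [x [y cE]] := pairs_surj c.+1.
have [e ye] := IHc y (pairs_lt cE isT).
by exists (x :: e), y.
Qed.

Lemma codes_nth c e e' : codes c e -> codes c e' -> forall i, nth 0 e i = nth 0 e' i.
Proof.
have nil0 e0 : codes 0 e0 -> forall i, nth 0 e0 i = 0.
  elim: e0 => [|x e0 IHe] /=; first by move=> _ i; rewrite nth_nil.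
  case=> c' p0 ce [|i] /=; first by move: p0; rewrite /pairs; nia.
  by apply: IHe; have <- : c' = 0 by move: p0; rewrite /pairs; nia.
elim: e c e' => [|x e IHe] c e'; first by move=> -> /nil0 e'0 i; rewrite nth_nil e'0.
case: e' => [|x' e']; first by move=> ce /= c0 i; rewrite c0 in ce; rewrite nth_nil nil0.
move=> /= [d cE de] [d' cE' de'].
have [xx' dd'] := pairs_inj cE cE'; subst x' d'.
by case=> //=; exact: IHe de de'.
Qed.

Lemma holds_ext f phi e e' :
  (forall i, nth 0 e i = nth 0 e' i) -> holds f e phi <-> holds f e' phi.
Proof.
have evalE t e1 e2 : (forall i, nth 0 e1 i = nth 0 e2 i) -> eval e1 t = eval e2 t.
  by move=> E; elim: t => //= [t ->|t -> u ->|t -> u ->].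
elim: phi e e' => /= [t u|t|p IHp|p IHp q IHq|p IHp q IHq|p IHp|p IHp] e e' E.
- by rewrite !(evalE _ _ _ E).
- by rewrite !(evalE _ _ _ E).
- by rewrite (IHp _ _ E).
- by rewrite (IHp _ _ E) (IHq _ _ E).
- by rewrite (IHp _ _ E) (IHq _ _ E).
- split=> H n; have /IHp Ep : forall i, nth 0 (n :: e) i = nth 0 (n :: e') i by case.
    by apply/Ep.
  by apply/Ep.
split=> -[n H]; exists n; have /IHp Ep : forall i, nth 0 (n :: e) i = nth 0 (n :: e') i by case.
  by apply/Ep.
by apply/Ep.
Qed.

Fixpoint var_value (i c v : nat) : Prop :=
  if i is j.+1 then exists x y, pairs c x y /\ var_value j y v
  else exists y, pairs c v y.

Fixpoint term_value (t : term) (c v : nat) : Prop :=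
  match t with
  | Var i => var_value i c v
  | Zero => v = 0
  | Succ u => exists x, term_value u c x /\ v = x.+1
  | Add u w => exists x y, term_value u c x /\ term_value w c y /\ v = x + y
  | Mul u w => exists x y, term_value u c x /\ term_value w c y /\ v = x * y
  end.

Lemma term_valueP t c e v : codes c e -> term_value t c v <-> v = eval e t.
Proof.
move=> ce; elim: t v => /= [i||t IHt|t IHt u IHu|t IHt u IHu] v //.
- elim: i c e ce => [|i IHi] c e ce /=; last first.
    have [x [y cE]] := pairs_surj c; have [e' ye'] := codes_surj y.
    have -> : nth 0 e i.+1 = nth 0 e' i by rewrite (@codes_nth c e (x :: e')) //; exists y.
    rewrite -(IHi _ _ ye'); split=> [[x' [y' [cE' yv]]]|yv]; last by exists x, y.
    by have [_ ->] := pairs_inj cE cE'.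
  have [x [y cE]] := pairs_surj c; have [e' ye'] := codes_surj y.
  have -> : nth 0 e 0 = x by rewrite (@codes_nth c e (x :: e')) //; exists y.
  split=> [[y' cE']|->]; last by exists y.
  by have [-> _] := pairs_inj cE cE'.
- split=> [[x [/IHt -> ->]] // | ->]; by exists (eval e t); split=> //; apply/IHt.
- split=> [[x [y [/IHt -> [/IHu -> ->]]]] // | ->].
  by exists (eval e t), (eval e u); split; [apply/IHt|split=> //; apply/IHu].
split=> [[x [y [/IHt -> [/IHu -> ->]]]] // | ->].
by exists (eval e t), (eval e u); split; [apply/IHt|split=> //; apply/IHu].
Qed.

Lemma definable_pairs b T1 T2 T3 : term_definable T1 -> term_definable T2 ->
  term_definable T3 -> definable b (fun=> fun e => pairs (T1 e) (T2 e) (T3 e)).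
Proof. by move=> d1 d2 d3; rewrite /pairs; define. Qed.

#[local] Hint Extern 1 (definable _ _) =>
  apply: definable_pairs; define_term : definable.

Lemma definable_term_value b t T1 T2 : term_definable T1 -> term_definable T2 ->
  definable b (fun=> fun e => term_value t (T1 e) (T2 e)).
Proof.
elim: t T1 T2 => /= [i||t IHt|t IHt u IHu|t IHt u IHu] T1 T2 d1 d2;
  try by [define].
- elim: i T1 T2 d1 d2 => [|i IHi] T1 T2 d1 d2 /=; first by define.
  apply: definable_ex; apply: definable_ex; apply: definable_and; first by define.
  by apply: IHi; define_term.
- by apply: definable_ex; apply: definable_and; [apply: IHt; define_term|define].
- apply: definable_ex; apply: definable_ex.
  by apply: definable_and; [apply: IHt; define_term
    |apply: definable_and; [apply: IHu; define_term|define]].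
apply: definable_ex; apply: definable_ex.
by apply: definable_and; [apply: IHt; define_term
  |apply: definable_and; [apply: IHu; define_term|define]].
Qed.

#[local] Hint Extern 1 (definable _ _) =>
  apply: definable_term_value; define_term : definable.

Fixpoint term_index (t : term) : nat :=
  match t with
  | Var i => CodeSeq.code [:: 0; i]
  | Zero => CodeSeq.code [:: 1]
  | Succ u => CodeSeq.code [:: 2; term_index u]
  | Add u v => CodeSeq.code [:: 3; term_index u; term_index v]
  | Mul u v => CodeSeq.code [:: 4; term_index u; term_index v]
  end.

Fixpoint formula_index (phi : formula) : nat :=
  match phi with
  | Eq t u => CodeSeq.code [:: 0; term_index t; term_index u]
  | Oracle t => CodeSeq.code [:: 1; term_index t]
  | Not p => CodeSeq.code [:: 2; formula_index p]
  | And p q => CodeSeq.code [:: 3; formula_index p; formula_index q]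
  | Or p q => CodeSeq.code [:: 4; formula_index p; formula_index q]
  | All p => CodeSeq.code [:: 5; formula_index p]
  | Ex p => CodeSeq.code [:: 6; formula_index p]
  end.

Arguments formula_index : simpl never.

Lemma term_index_inj : injective term_index.
Proof.
have code_inj := can_inj CodeSeq.codeK.
elim=> [i||t IHt|t IHt u IHu|t IHt u IHu] [j||t'|t' u'|t' u'] /code_inj //.
- by case=> ->.
- by case=> /IHt ->.
- by case=> /IHt -> /IHu ->.
by case=> /IHt -> /IHu ->.
Qed.

Lemma formula_index_inj : injective formula_index.
Proof.
have code_inj := can_inj CodeSeq.codeK.
elim=> [t u|t|p IHp|p IHp q IHq|p IHp q IHq|p IHp|p IHp]
  [t' u'|t'|p'|p' q'|p' q'|p'|p'] /code_inj //.
- by case=> /term_index_inj -> /term_index_inj ->.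
- by case=> /term_index_inj ->.
- by case=> /IHp ->.
- by case=> /IHp -> /IHq ->.
- by case=> /IHp -> /IHq ->.
- by case=> /IHp ->.
by case=> /IHp ->.
Qed.

Notation truth G phi c := (G (pr (formula_index phi) c)).

(* The Tarski conditions at the environment coded by [c], for a truth table [G]
   of all subformulas of [phi]; each is an existential condition on [G]. *)
Fixpoint tarski (G : nat -> bool) (phi : formula) (c : nat) : Prop :=
  match phi with
  | Eq t u => exists x y, term_value t c x /\ term_value u c y /\
      (truth G phi c /\ x = y \/ ~~ truth G phi c /\ x <> y)
  | Oracle t => exists x d, term_value t c x /\ pairs d x 0 /\
      (truth G phi c /\ truth G (Oracle (Var 0)) d
       \/ ~~ truth G phi c /\ ~~ truth G (Oracle (Var 0)) d)
  | Not p =>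
      (truth G phi c /\ ~~ truth G p c \/ ~~ truth G phi c /\ truth G p c)
      /\ tarski G p c
  | And p q =>
      (truth G phi c /\ truth G p c /\ truth G q c
       \/ ~~ truth G phi c /\ (~~ truth G p c \/ ~~ truth G q c))
      /\ tarski G p c /\ tarski G q c
  | Or p q =>
      (truth G phi c /\ (truth G p c \/ truth G q c)
       \/ ~~ truth G phi c /\ ~~ truth G p c /\ ~~ truth G q c)
      /\ tarski G p c /\ tarski G q c
  | All p =>
      (truth G phi c \/ exists x d, pairs d x c /\ ~~ truth G p d)
      /\ (exists x c', pairs c x c' /\ (truth G p c \/ ~~ truth G phi c'))
      /\ tarski G p c
  | Ex p =>
      (~~ truth G phi c \/ exists x d, pairs d x c /\ truth G p d)
      /\ (exists x c', pairs c x c' /\ (~~ truth G p c \/ truth G phi c'))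
      /\ tarski G p c
  end.

Lemma definable_tarski phi T :
  term_definable T -> definable true (fun G e => tarski G phi (T e)).
Proof.
elim: phi => [t u|t|p IHp|p IHp q IHq|p IHp q IHq|p IHp|p IHp] defT /=;
  do ?[apply: definable_and; last by [exact: IHp | exact: IHq]];
  do ?[apply: definable_and; last by apply: definable_and; [exact: IHp|exact: IHq]];
  do ?[apply: definable_and; last by apply: definable_and; [|exact: IHp]; rewrite /pr; define];
  by rewrite /pr; define.
Qed.

(** Induction on [phi], for the oracle read off the entries of [Oracle (Var 0)] at one-element
    environments. For a quantifier, the condition at [c] supplies the witness or the counterexample,
    while the implication between the formula and its instance at x is the condition at the longer
    environment [cantor x c], which the hypothesis for all codes contains. *)
Lemma tarski_sound (G : nat -> bool) phi :
  (forall c, tarski G phi c) ->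
  forall c e, codes c e ->
  truth G phi c <->
  holds (fun x => truth G (Oracle (Var 0)) (cantor x 0)) e phi.
Proof.
elim: phi => [t u|t|p IHp|p IHp q IHq|p IHp q IHq|p IHp|p IHp] /= Gphi c e ce.
- have [x [y [/(term_valueP _ _ ce) -> [/(term_valueP _ _ ce) -> E]]]] := Gphi c.
  by case: E => [[-> ->]//|[/negPf -> ne]]; split.
- have [x [d [/(term_valueP _ _ ce) -> [/pairsP -> E]]]] := Gphi c.
  by case: E => [[-> ->]//|[/negPf -> /negPf ->]]; split.
- have /IHp/(_ c e ce) <- : forall c, tarski G p c by move=> d; case: (Gphi d).
  by case: (Gphi c) => [[[-> /negPf ->]|[/negPf -> ->]] _]; split.
- have /IHp/(_ c e ce) <- : forall c, tarski G p c by move=> d; case: (Gphi d) => _ [].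
  have /IHq/(_ c e ce) <- : forall c, tarski G q c by move=> d; case: (Gphi d) => _ [].
  case: (Gphi c) => [[[-> [-> ->]]|[/negPf -> [] /negPf ->]] _]; split=> //; by case.
- have /IHp/(_ c e ce) <- : forall c, tarski G p c by move=> d; case: (Gphi d) => _ [].
  have /IHq/(_ c e ce) <- : forall c, tarski G q c by move=> d; case: (Gphi d) => _ [].
  case: (Gphi c) => [[[-> E]|[/negPf -> [/negPf -> /negPf ->]]] _]; split=> //; by case.
- have {}IHp := IHp (fun d => proj2 (proj2 (Gphi d))).
  split=> [Gc x|Gall].
    have /pairsP cE := erefl (cantor x c); apply/(IHp (cantor x c)); first by exists c.
    have [_ [[x' [c' [cE' E]]] _]] := Gphi (cantor x c).
    have [_ cc'] := pairs_inj cE cE'; subst c'.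
    by case: E => //; rewrite Gc.
  have [[Gc|[x [d [dE Gd]]]] _] := Gphi c; [by []|case/negP: Gd].
  by apply/(IHp d (x :: e)); first by exists c.
have {}IHp := IHp (fun d => proj2 (proj2 (Gphi d))).
split=> [Gc|[x /IHp Gx]].
  have [[nGc|[x [d [dE Gd]]]] _] := Gphi c; first by rewrite Gc in nGc.
  by exists x; apply/(IHp d) => //; exists c.
have /pairsP cE := erefl (cantor x c).
have [_ [[x' [c' [cE' E]]] _]] := Gphi (cantor x c).
have [_ cc'] := pairs_inj cE cE'; subst c'.
by case: E => //; rewrite Gx //; exists c.
Qed.

(** The true table is well defined on codes because environments with the same code differ by
    padding zeros, which [holds_ext] ignores. *)
Lemma tarski_complete f : exists G : nat -> bool,
  (forall psi c e, codes c e -> truth G psi c <-> holds f e psi) /\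
  forall phi c, tarski G phi c.
Proof.
pose P k := exists psi c e,
  k = pr (formula_index psi) c /\ codes c e /\ holds f e psi.
pose G k := to_bool (P k); exists G.
have GE psi c e : codes c e -> truth G psi c <-> holds f e psi.
  move=> ce; split=> [/to_boolP|fe]; last by apply/to_boolP; exists psi, c, e.
  case=> psi' [c' [e' [/pr_inj[/formula_index_inj <- <-] [ce']]]].
  by apply: (proj1 (holds_ext _ _ _)); exact: codes_nth ce' ce.
have NGE psi c e : codes c e -> ~~ truth G psi c <-> ~ holds f e psi.
  by move=> /(GE psi) <-; split=> /negP.
split=> //; move=> phi c; have [e ce] := codes_surj c.
have [x [c' cE]] := pairs_surj c; have [e' ce'] := codes_surj c'.
have ce2 : codes c (x :: e') by exists c'.
elim: phi => [t u|t|p IHp|p IHp q IHq|p IHp q IHq|p IHp|p IHp] /=.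
- exists (eval e t), (eval e u).
  split; first exact/(term_valueP _ _ ce); split; first exact/(term_valueP _ _ ce).
  by rewrite (GE _ _ e) ?(NGE _ _ e) //=; case: (classic (eval e t = eval e u)); tauto.
- have /pairsP dE := erefl (cantor (eval e t) 0).
  exists (eval e t), (cantor (eval e t) 0); split; first exact/(term_valueP _ _ ce).
  split=> //; have de : codes (cantor (eval e t) 0) [:: eval e t] by exists 0.
  have := GE (Oracle t) _ _ ce; have := GE (Oracle (Var 0)) _ _ de => /=.
  by do 2![case: (G _)]; case: (f _) => -[a1 a2] [b1 b2]; auto; exfalso; auto.
- split=> //; rewrite !(GE _ _ e) ?(NGE _ _ e) //=.
  by case: (classic (holds f e p)); tauto.
- split=> //; rewrite !(GE _ _ e) ?(NGE _ _ e) //=.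
  by case: (classic (holds f e p)); case: (classic (holds f e q)); tauto.
- split=> //; rewrite !(GE _ _ e) ?(NGE _ _ e) //=.
  by case: (classic (holds f e p)); case: (classic (holds f e q)); tauto.
- split; last split=> //; last first.
    exists x, c'; split=> //; rewrite (GE _ _ (x :: e')) // (NGE _ _ e') //=.
    by case: (classic (holds f (x :: e') p)) => H; [left|right=> /(_ x)].
  rewrite (GE _ _ e) //=.
  case: (classic (forall n, holds f (n :: e) p)) => [|/not_all_ex_not[n Hn]]; first by left.
  right; have /pairsP dE := erefl (cantor n c); exists n, (cantor n c); split=> //.
  by rewrite (NGE _ _ (n :: e)) //; exists c.
split; last split=> //; last first.
  exists x, c'; split=> //; rewrite (NGE _ _ (x :: e')) // (GE _ _ e') //=.
  by case: (classic (holds f (x :: e') p)) => H; [right; exists x|left].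
rewrite (NGE _ _ e) //=.
case: (classic (exists n, holds f (n :: e) p)) => [[n Hn]|]; last by left.
right; have /pairsP dE := erefl (cantor n c); exists n, (cantor n c); split=> //.
by rewrite (GE _ _ (n :: e)) //; exists c.
Qed.

(** The witness f is traded for a truth table in which [phi] is true at n. In [chi], variable 0 is n
    and variable 1 is the code at which the Tarski conditions are checked. *)
Lemma Sigma11_normal_form Q : Sigma11 Q ->
  exists2 chi, existential chi &
    forall n, Q n <-> exists G, forall c, holds G [:: n; c] chi.
Proof.
case=> R [phi phiE] QE.
have [chi chi1 chiE] : definable true (fun G e =>
    (exists d, pairs d (head 0 e) 0 /\ truth G phi d)
    /\ tarski G phi (head 0 (behead e))).
  apply: definable_and; last by apply: definable_tarski; define_term.
  by rewrite /pr; define.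
exists chi => // n; rewrite QE; split=> [[f /phiE fn]|[G /(_ _)/chiE/= Gn]].
  have [G [GE Gt]] := tarski_complete f; exists G => c; apply/chiE; split=> //=.
  have /pairsP dE := erefl (cantor n 0); exists (cantor n 0); split=> //.
  by apply/(GE _ _ [:: n]) => //; exists 0.
exists (fun x => truth G (Oracle (Var 0)) (cantor x 0)); apply/phiE.
have [[d [dE Gd]] _] := Gn 0.
by apply/(tarski_sound _ (c := d)) => //; [move=> c; case: (Gn c)|exists 0].
Qed.

(** * Nondeterministic register programs with an oracle *)

Inductive op : Type :=
| Reset of nat
| Incr of nat
| Test of nat & nat
| Look of nat & bool
| Skip
| Mark of bool.

Inductive prog : Type :=
| Atom of op
| Seq of prog & prog
| Alt of prog & prog
| Star of prog.

Definition env := nat -> nat.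

Definition upd (s : env) (x v : nat) : env := fun y => if y == x then v else s y.

Definition exec (o : op) (s : env) : env :=
  match o with
  | Reset x => upd s x 0
  | Incr x => upd s x (s x).+1
  | _ => s
  end.

Section Runs.
Variable G : nat -> bool.

Definition guard (o : op) (s : env) : Prop :=
  match o with
  | Test x y => s x = s y
  | Look x b => G (s x) = b
  | _ => True
  end.

Definition is_mark (o : op) : bool := if o is Mark _ then true else false.

(** Marks are excluded: they are issued by the main loop between two bodies, never inside one. *)
Inductive run : prog -> env -> env -> Prop :=
| run_atom o s : ~~ is_mark o -> guard o s -> run (Atom o) s (exec o s)
| run_seq p q s1 s2 s3 : run p s1 s2 -> run q s2 s3 -> run (Seq p q) s1 s3
| run_altl p q s s' : run p s s' -> run (Alt p q) s s'
| run_altr p q s s' : run q s s' -> run (Alt p q) s s'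
| run_star0 p s : run (Star p) s s
| run_starS p s1 s2 s3 : run p s1 s2 -> run (Star p) s2 s3 -> run (Star p) s1 s3.

Lemma run_atomE o s s' : run (Atom o) s s' <-> [/\ ~~ is_mark o, guard o s & s' = exec o s].
Proof. by split=> [H|[no go ->]]; [inversion H|exact: run_atom]. Qed.

Lemma run_seqE p q s s' :
  run (Seq p q) s s' <-> exists2 s1, run p s s1 & run q s1 s'.
Proof. by split=> [H|[s1]]; [inversion H; subst; exists s2|exact: run_seq]. Qed.

Lemma run_altE p q s s' : run (Alt p q) s s' <-> run p s s' \/ run q s s'.
Proof.
split=> [H|[]]; [inversion H; subst; by [left|right]|exact: run_altl|exact: run_altr].
Qed.

Lemma run_star_inv (P : env -> env -> Prop) p :
  (forall s, P s s) ->
  (forall s1 s2 s3, run p s1 s2 -> P s2 s3 -> P s1 s3) ->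
  forall s s', run (Star p) s s' -> P s s'.
Proof.
move=> P0 PS s s' H; move: {-2}(Star p) (erefl (Star p)) H => q qE H.
elim: H qE => // q0 t1 t2 t3 r _ _ IH [qE].
by rewrite qE in r; apply: PS r (IH _); rewrite qE.
Qed.

Lemma run_star_iter p (u : nat -> env) n :
  (forall i, i < n -> run p (u i) (u i.+1)) -> run (Star p) (u 0) (u n).
Proof.
elim: n u => [|n IHn] u H; first exact: run_star0.
apply: run_starS (H 0 isT) _; apply: (IHn (fun i => u i.+1)) => i ni; exact: H.
Qed.

End Runs.

(** * Compilation of existential formulas into programs *)

Definition agree (k : nat) (s s' : env) : Prop := forall i, i < k -> s i = s' i.

(** Registers cannot be copied or decremented, because cosets can only be reset or halved. A copy is
    therefore guessed, counting up from 0, and checked by a [Test]. *)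
Definition reg_or_zero (rs : seq nat) (i k : nat) : prog :=
  if i < size rs
  then Seq (Atom (Reset k)) (Seq (Star (Atom (Incr k))) (Atom (Test k (nth 0 rs i))))
  else Atom (Reset k).

Definition adder (x y z : nat) : prog :=
  Seq (Atom (Reset y))
    (Seq (Star (Seq (Atom (Incr x)) (Atom (Incr y)))) (Atom (Test y z))).

(* [rs] lists the registers holding the environment; the result goes to
   register [k], and registers above [k] are scratch. *)
Fixpoint compile_term (rs : seq nat) (k : nat) (t : term) : prog :=
  match t with
  | Var i => reg_or_zero rs i k
  | Zero => Atom (Reset k)
  | Succ u => Seq (compile_term rs k u) (Atom (Incr k))
  | Add u v =>
    Seq (compile_term rs k u) (Seq (compile_term rs k.+1 v) (adder k k.+2 k.+1))
  | Mul u v =>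
    (* The factors are in [k.+1] and [k.+2], the product accumulates in [k], [k.+3] counts the
       additions and [k.+4] is the counter of the adder. *)
    Seq (compile_term rs k.+1 u) (Seq (compile_term rs k.+2 v)
      (Seq (Atom (Reset k)) (Seq (Atom (Reset k.+3))
        (Seq (Star (Seq (Atom (Incr k.+3)) (adder k k.+4 k.+2)))
             (Atom (Test k.+3 k.+1))))))
  end.

Fixpoint compile (rs : seq nat) (k : nat) (phi : formula) : prog :=
  match phi with
  | Eq t u =>
    Seq (compile_term rs k t) (Seq (compile_term rs k.+1 u) (Atom (Test k k.+1)))
  | Oracle t => Seq (compile_term rs k t) (Atom (Look k true))
  | Not (Oracle t) => Seq (compile_term rs k t) (Atom (Look k false))
  | And p q => Seq (compile rs k p) (compile rs k q)
  | Or p q => Alt (compile rs k p) (compile rs k q)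
  | Ex p => Seq (Atom (Reset k)) (Seq (Star (Atom (Incr k))) (compile (k :: rs) k.+1 p))
  | _ => Atom Skip
  end.

Section CompileCorrect.
Variable G : nat -> bool.

(** Runs with a wrong guess block at a [Test], so all completed runs can agree although the program
    is nondeterministic. *)
Definition computes k (F : env -> nat) p :=
  forall s, (forall s', run G p s s' -> s' k = F s /\ agree k s' s)
    /\ exists s', run G p s s'.

Lemma run_incr k s s' : run G (Star (Atom (Incr k))) s s' -> agree k s' s.
Proof.
apply: (run_star_inv (P := fun s s' => agree k s' s)) => // s1 s2 s3.
move=> /run_atomE[_ _ ->] agr i ik; rewrite agr //= /upd; case: eqP => //; lia.
Qed.

Lemma run_incr_to k s n : exists2 s',
  run G (Seq (Atom (Reset k)) (Star (Atom (Incr k)))) s s' & s' k = n /\ agree k s' s.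
Proof.
exists (iter n (exec (Incr k)) (upd s k 0)); last first.
  elim: n => [|n [IH1 IH2]] /=; rewrite /upd; first by rewrite eqxx; split=> // i ik; case: eqP => //; lia.
  by rewrite eqxx IH1; split=> // i ik; rewrite IH2 //; case: eqP => //; lia.
apply/run_seqE; exists (upd s k 0); first exact: (@run_atom _ (Reset k)).
apply: (run_star_iter (u := fun n => iter n (exec (Incr k)) (upd s k 0))) => i _.
exact: (@run_atom _ (Incr k)).
Qed.

Lemma adder_sound x y z s s' : x != y -> z != x -> z != y ->
  run G (adder x y z) s s' ->
  s' x = s x + s z /\ forall i, i != x -> i != y -> s' i = s i.
Proof.
move=> xy zx zy /run_seqE[_ /run_atomE[_ _ ->]] /run_seqE[s1 H /run_atomE[_ /= E ->]].
suff [s1x s1i] : s1 x + upd s y 0 y = s x + s1 y /\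
    forall i, i != x -> i != y -> s1 i = upd s y 0 i.
  rewrite E (s1i z) // /upd eqxx (negPf zy) in s1x.
  by split=> [|i ix iy]; [lia|rewrite s1i // /upd (negPf iy)].
have -> : s x = upd s y 0 x by rewrite /upd (negPf xy).
change (exec (Reset y) s) with (upd s y 0) in H.
(* The loop preserves the difference of x and y, here written without subtraction. *)
move: (upd s y 0) s1 H {E}; apply: (run_star_inv (P := fun s0 s1 =>
  s1 x + s0 y = s0 x + s1 y /\ forall i, i != x -> i != y -> s1 i = s0 i)) => //.
move=> s1 s2 s3.
move=> /run_seqE[_ /run_atomE[_ _ ->] /run_atomE[_ _ ->]] /= [].
rewrite /upd !eqxx (negPf xy) [y == x]eq_sym (negPf xy) => E1 E2.
by split=> [|i ix iy]; [lia|rewrite E2 // (negPf ix) (negPf iy)].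
Qed.

Lemma adder_complete x y z s : x != y -> z != x -> z != y ->
  exists s', run G (adder x y z) s s'.
Proof.
move=> xy zx zy.
pose u := fun n => iter n (fun s => exec (Incr y) (exec (Incr x) s)) (upd s y 0).
have uE n : u n y = n /\ u n z = s z.
  elim: n => [|n [IH1 IH2]]; rewrite /u /= /upd ?eqxx ?(negPf zy) //.
  by rewrite -/(u n) (negPf zx) [y == x]eq_sym (negPf xy) IH1 IH2.
exists (u (s z)); apply/run_seqE; exists (u 0); first exact: (@run_atom _ (Reset y)).
apply/run_seqE; exists (u (s z)).
  apply: run_star_iter => i _; apply/run_seqE; exists (exec (Incr x) (u i)).
    exact: (@run_atom _ (Incr x)).
  exact: (@run_atom _ (Incr y)).
by apply: (@run_atom _ (Test y z)) => //=; rewrite !(proj1 (uE _)) (proj2 (uE _)).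
Qed.

Lemma map_agree k rs (s s' : env) :
  all (fun r => r < k) rs -> agree k s' s -> map s' rs = map s rs.
Proof. by move=> /allP rsk agr; apply/eq_in_map => r /rsk /agr. Qed.

Lemma all_widen k k' rs : k <= k' ->
  all (fun r => r < k) rs -> all (fun r => r < k') rs.
Proof. by move=> kk'; apply: sub_all => r /leq_trans; exact. Qed.

Lemma compile_termP t rs k : all (fun r => r < k) rs ->
  computes k (fun s => eval (map s rs) t) (compile_term rs k t).
Proof.
elim: t k => [i||u IHu|u IHu v IHv|u IHu v IHv] k rsk s /=.
- rewrite /reg_or_zero; case: ltnP => i_rs; last first.
    rewrite nth_default ?size_map //.
    split=> [s' /run_atomE[_ _ ->]|]; last by exists (upd s k 0); exact: (@run_atom _ (Reset k)).
    by rewrite /= /upd eqxx; split=> // j jk; case: eqP => //; lia.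
  have rk : nth 0 rs i < k by apply: (allP rsk); exact: mem_nth.
  rewrite (nth_map 0) //; split=> [s'|].
    move=> /run_seqE[_ /run_atomE[_ _ ->]] /run_seqE[s1 /run_incr agr /run_atomE[_ /= E ->]].
    have agr' : agree k s1 s by move=> j jk; rewrite agr //= /upd; case: eqP => //; lia.
    by split=> //; rewrite E agr'.
  have [s' H [s'k agr]] := run_incr_to k s (s (nth 0 rs i)).
  exists s'; case/run_seqE: H => s1 H1 H2; apply/run_seqE; exists s1 => //.
  apply/run_seqE; exists s' => //; apply: (@run_atom _ (Test _ _)) => //=.
  by rewrite s'k agr.
- split=> [s' /run_atomE[_ _ ->]|]; last by exists (upd s k 0); exact: (@run_atom _ (Reset k)).
  by rewrite /= /upd eqxx; split=> // j jk; case: eqP => //; lia.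
- have [sound [s1 run1]] := IHu _ rsk s; split=> [s' /run_seqE[s2 /sound[E agr]]|].
    move=> /run_atomE[_ _ ->] /=; rewrite /upd eqxx E; split=> // j jk.
    by rewrite agr //; case: eqP => //; lia.
  exists (exec (Incr k) s1); apply/run_seqE; exists s1 => //; exact: (@run_atom _ (Incr k)).
- have rsk1 := all_widen (leqnSn k) rsk.
  have n1 : k != k.+2 by lia.
  have n2 : k.+1 != k by lia.
  have n3 : k.+1 != k.+2 by lia.
  have [sound1 [s1 run1]] := IHu _ rsk s; split.
    move=> s' /run_seqE[s2 /sound1[E2 agr2]] /run_seqE[s3 /(proj1 (IHv _ rsk1 s2))[E3 agr3]].
    move=> /adder_sound-/(_ n1 n2 n3)[E agr].
    rewrite E E3 agr3 // E2 (map_agree rsk agr2); split=> // j jk.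
    by rewrite agr ?agr3 ?agr2 //; lia.
  have [_ [s2 run2]] := IHv _ rsk1 s1; have [s3 run3] := adder_complete s2 n1 n2 n3.
  exists s3; apply/run_seqE; exists s1 => //; apply/run_seqE; by exists s2.
have rsk1 := all_widen (leqnSn k) rsk.
have rsk2 := all_widen (leqnSn k.+1) rsk1.
have n1 : k != k.+4 by lia.
have n2 : k.+2 != k by lia.
have n3 : k.+2 != k.+4 by lia.
have [sound1 [s1 run1]] := IHu _ rsk1 s; split.
  move=> s' /run_seqE[s2 /sound1[E2 agr2]] /run_seqE[s3 /(proj1 (IHv _ rsk2 s2))[E3 agr3]].
  move=> /run_seqE[_ /run_atomE[_ _ ->]] /run_seqE[_ /run_atomE[_ _ ->]].
  move=> /run_seqE[s4 H /run_atomE[_ /= E ->]].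
  rewrite /= in H; set s0 := upd _ k.+3 0 in H.
  have s0j j : j < k -> s0 j = s j.
    by move=> jk; rewrite /s0 /upd; do 2![case: eqP => [|_]; first by lia]; rewrite agr3 ?agr2 //; lia.
  (* The loop preserves the accumulator minus the counter times the second factor; again no
     subtraction is used. *)
  suff [E4 agr4] : s4 k + s0 k.+3 * s0 k.+2 = s0 k + s4 k.+3 * s0 k.+2 /\
      forall j, j < k \/ j = k.+1 \/ j = k.+2 -> s4 j = s0 j.
    have ek1 : s0 k.+1 = eval [seq s i | i <- rs] u.
      by rewrite /s0 /upd; do 2![case: eqP => [|_]; first by lia]; rewrite agr3 // E2.
    have ek2 : s0 k.+2 = eval [seq s i | i <- rs] v.
      rewrite /s0 /upd; do 2![case: eqP => [|_]; first by lia].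
      by rewrite E3 (map_agree rsk1 agr2).
    rewrite E (agr4 k.+1) ?ek1 ?ek2 in E4; last by lia.
    split=> [|j jk]; last by rewrite agr4 ?s0j //; lia.
    by move: E4; rewrite {1 2}/s0 /upd !eqxx if_same mul0n addn0 add0n.
  move: s0 s4 H {E s0j}; apply: (run_star_inv (P := fun s0 s4 =>
    s4 k + s0 k.+3 * s0 k.+2 = s0 k + s4 k.+3 * s0 k.+2 /\
    forall j, j < k \/ j = k.+1 \/ j = k.+2 -> s4 j = s0 j)) => // t1 t2 t3.
  move=> /run_seqE[_ /run_atomE[_ _ ->]] /adder_sound-/(_ n1 n2 n3)[].
  rewrite /= {1 2}/upd; do 2![case: eqP => [|_]; first by lia] => Ek agr [E' agr'].
  have t2k2 : t2 k.+2 = t1 k.+2 by rewrite agr ?/upd; [case: eqP => //; lia|lia|lia].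
  have t2k3 : t2 k.+3 = (t1 k.+3).+1 by rewrite agr ?/upd ?eqxx //; lia.
  split=> [|j jk]; first by rewrite t2k2 t2k3 Ek in E'; nia.
  by rewrite agr' // agr ?/upd; [case: eqP => //; lia|lia|lia].
have [_ [s2 run2]] := IHv _ rsk2 s1.
(* The loop body has a run from every environment; choosing one for each makes the loop an
   iteration. *)
pose step (s : env) := epsilon (inhabits s)
  (fun s' => run G (Seq (Atom (Incr k.+3)) (adder k k.+4 k.+2)) s s').
have stepP t : run G (Seq (Atom (Incr k.+3)) (adder k k.+4 k.+2)) t (step t).
  rewrite /step; apply: epsilon_spec.
  have [t' H] := adder_complete (exec (Incr k.+3) t) n1 n2 n3.
  by exists t'; apply/run_seqE; exists (exec (Incr k.+3) t) => //; exact: (@run_atom _ (Incr k.+3)).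
pose w n := iter n step (upd (upd s2 k 0) k.+3 0).
have wE n : w n k.+3 = n /\ w n k.+1 = s2 k.+1.
  elim: n => [|n [IH1 IH2]].
    by rewrite /w /= /upd eqxx; do 2![case: eqP => [|_]; first by lia].
  case/run_seqE: (stepP (w n)) => _ /run_atomE[_ _ ->] /adder_sound-/(_ n1 n2 n3)[_ agr].
  rewrite /w iterS -/(w n) !agr ?/= ?/upd ?eqxx; try lia.
  by rewrite IH1; split=> //; case: eqP => //; lia.
exists (w (s2 k.+1)); apply/run_seqE; exists s1 => //; apply/run_seqE; exists s2 => //.
apply/run_seqE; exists (upd s2 k 0); first exact: (@run_atom _ (Reset k)).
apply/run_seqE; exists (w 0); first exact: (@run_atom _ (Reset k.+3)).
apply/run_seqE; exists (w (s2 k.+1)); first by apply: run_star_iter => i _; exact: stepP.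
by apply: (@run_atom _ (Test _ _)) => //=; rewrite (proj1 (wE _)) (proj2 (wE _)).
Qed.

Lemma compileP phi rs k : existential phi -> all (fun r => r < k) rs ->
  forall s, (forall s', run G (compile rs k phi) s s' ->
               holds G (map s rs) phi /\ agree k s' s)
    /\ (holds G (map s rs) phi -> exists s', run G (compile rs k phi) s s').
Proof.
elim: phi rs k => //= [t u|t|p IHp|p IHp q IHq|p IHp q IHq|p IHp] rs k.
- move=> _ rsk s; have rsk1 := all_widen (leqnSn k) rsk.
  have [sound [s1 run1]] := compile_termP t rsk s; split.
    move=> s' /run_seqE[s2 /sound[E agr]] /run_seqE[s3 /(proj1 (compile_termP u rsk1 s2))[E' agr'] /run_atomE[_ /= Ek ->]].
    split=> [|j jk]; last by rewrite agr' ?agr //; lia.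
    by rewrite -E -agr' // Ek E' (map_agree rsk agr).
  move=> E; have [sound2 [s2 run2]] := compile_termP u rsk1 s1; exists s2.
  apply/run_seqE; exists s1 => //; apply/run_seqE; exists s2 => //.
  apply: (@run_atom _ (Test _ _)) => //=; have [E2 agr2] := sound2 _ run2.
  have [E1 agr1] := sound _ run1.
  by rewrite agr2 // E1 E E2 (map_agree rsk agr1).
- move=> _ rsk s; have [sound [s1 run1]] := compile_termP t rsk s; split.
    by move=> s' /run_seqE[s2 /sound[E agr] /run_atomE[_ /= Ek ->]]; rewrite -E Ek.
  move=> E; exists s1; apply/run_seqE; exists s1 => //.
  by apply: (@run_atom _ (Look _ _)) => //=; rewrite (proj1 (sound _ run1)).
- case: p {IHp} => // t _ rsk s; have [sound [s1 run1]] := compile_termP t rsk s; split.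
    by move=> s' /run_seqE[s2 /sound[E agr] /run_atomE[_ /= Ek ->]]; rewrite /= -E Ek.
  move=> /= /negP/negPf E; exists s1; apply/run_seqE; exists s1 => //.
  by apply: (@run_atom _ (Look _ _)) => //=; rewrite (proj1 (sound _ run1)).
- move=> /andP[exp exq] rsk s; split.
    move=> s' /run_seqE[s1 /(proj1 (IHp _ _ exp rsk s))[Hp agr] /(proj1 (IHq _ _ exq rsk s1))[Hq agr']].
    rewrite (map_agree rsk agr) in Hq; split=> // j jk; by rewrite agr' ?agr.
  case=> /(proj2 (IHp _ _ exp rsk s))[s1 run1] Hq.
  have [_ agr] := proj1 (IHp _ _ exp rsk s) _ run1.
  rewrite -(map_agree rsk agr) in Hq; have [s2 run2] := proj2 (IHq _ _ exq rsk s1) Hq.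
  by exists s2; apply/run_seqE; exists s1.
- move=> /andP[exp exq] rsk s; split.
    by move=> s' /run_altE[/(proj1 (IHp _ _ exp rsk s))[]|/(proj1 (IHq _ _ exq rsk s))[]]; auto.
  by case=> [/(proj2 (IHp _ _ exp rsk s))|/(proj2 (IHq _ _ exq rsk s))] [s' H];
    exists s'; apply/run_altE; auto.
move=> exp rsk s.
have rsk1 : all (fun r => r < k.+1) (k :: rs) by rewrite /= leqnn; exact: all_widen (leqnSn k) rsk.
split.
  move=> s' /run_seqE[_ /run_atomE[_ _ ->]] /run_seqE[s1 /run_incr agr].
  have agr1 : agree k s1 s by move=> j jk; rewrite agr // /= /upd; case: eqP => //; lia.
  case/(proj1 (IHp _ _ exp rsk1 s1)) => /= Hp agr'; rewrite (map_agree rsk agr1) in Hp.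
  by split; [exists (s1 k)|move=> j jk; rewrite agr' ?agr1 //; lia].
case=> n Hn; have [s1 run1 [s1k agr1]] := run_incr_to k s n.
have [|s2 run2] := proj2 (IHp _ _ exp rsk1 s1); first by rewrite /= s1k (map_agree rsk agr1).
case/run_seqE: run1 => s0 run0 run1; exists s2.
by apply/run_seqE; exists s0 => //; apply/run_seqE; exists s1.
Qed.

End CompileCorrect.

(** Register 0 holds the input and register 1 the number of the current instance; registers from 2
    on are scratch. The last increment passes to the next instance. *)
Definition body (chi : formula) : prog :=
  Seq (compile [:: 0; 1] 2 chi) (Atom (Incr 1)).

Lemma body_sound G chi s s' : existential chi -> run G (body chi) s s' ->
  [/\ holds G [:: s 0; s 1] chi, s' 0 = s 0 & s' 1 = (s 1).+1].
Proof.
move=> exchi /run_seqE[s1 /(proj1 (@compileP G chi [:: 0; 1] 2 exchi isT s))[Hchi agr] /run_atomE[_ _ ->]].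
by split=> //=; rewrite /upd /= agr.
Qed.

Lemma body_complete G chi s : existential chi -> holds G [:: s 0; s 1] chi ->
  exists s', run G (body chi) s s'.
Proof.
move=> exchi /(proj2 (@compileP G chi [:: 0; 1] 2 exchi isT s))[s1 run1].
exists (exec (Incr 1) s1); apply/run_seqE; exists s1 => //.
exact: (@run_atom _ (Incr 1)).
Qed.

(** * Small-step executions *)

Lemma op_eq_dec : comparable op.
Proof. by rewrite /comparable /decidable; do ?decide equality. Qed.
HB.instance Definition _ := hasDecEq.Build op (compareP op_eq_dec).

Lemma prog_eq_dec : comparable prog.
Proof. by move=> p q; rewrite /decidable; decide equality; exact: op_eq_dec. Qed.
HB.instance Definition _ := hasDecEq.Build prog (compareP prog_eq_dec).

(* [None] is the phase that loads the input into register 0; [Some K] is the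
   stack [K] of programs still to be run, and [Some [::]] the waiting phase
   between two rounds of the main loop. *)
Definition state : Type := option (seq prog).

(** The waiting state may idle for as long as the flood needs. Its only other exits are the two
    marks, each of which starts a new round. *)
Definition moves (p0 : prog) (K : state) : seq (op * state) :=
  match K with
  | None => [:: (Incr 0, None); (Skip, Some [::])]
  | Some [::] =>
    [:: (Skip, Some [::]); (Mark true, Some [:: p0]); (Mark false, Some [:: p0])]
  | Some (Atom o :: K) => if is_mark o then [::] else [:: (o, Some K)]
  | Some (Seq p q :: K) => [:: (Skip, Some [:: p, q & K])]
  | Some (Alt p q :: K) => [:: (Skip, Some (p :: K)); (Skip, Some (q :: K))]
  | Some (Star p :: K) => [:: (Skip, Some K); (Skip, Some [:: p, Star p & K])]
  end.

(** Each subprogram is executed on top of a remainder determined by its place in the program, so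
    only finitely many stacks occur. This makes the alphabet of tiles finite. *)
Fixpoint conts (p : prog) (K : seq prog) : seq (seq prog) :=
  (p :: K) :: match p with
  | Atom _ => [::]
  | Seq p q => conts p (q :: K) ++ conts q K
  | Alt p q => conts p K ++ conts q K
  | Star q => conts q (p :: K)
  end.

Lemma conts_self p K : p :: K \in conts p K.
Proof. by case: p => *; rewrite mem_head. Qed.

Lemma conts_closed p0 p K K1 o K2 : K1 \in conts p K ->
  (o, K2) \in moves p0 (Some K1) -> exists2 K3, K2 = Some K3 & K3 \in K :: conts p K.
Proof.
elim: p K K1 => [a|p IHp q IHq|p IHp q IHq|p IHp] K K1 /=; rewrite inE.
- by move=> /eqP -> /=; case: ifP => // _; rewrite inE => /eqP[_ ->]; exists K; rewrite // mem_head.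
- case/orP=> [/eqP -> /=|].
    by rewrite inE => /eqP[_ ->]; exists [:: p, q & K]; rewrite // !inE mem_cat conts_self !orbT.
  rewrite mem_cat => /orP[/IHp H|/IHq H] /H[K3 ->]; rewrite inE => H3; exists K3 => //; move: H3.
    by case/orP=> [/eqP ->|H3]; rewrite !inE mem_cat ?conts_self ?H3 !orbT.
  by case/orP=> [/eqP ->|H3]; rewrite !inE mem_cat ?eqxx ?H3 ?orbT.
- case/orP=> [/eqP -> /=|].
    by rewrite !inE => /orP[] /eqP[_ ->]; eexists; rewrite // !inE mem_cat conts_self !orbT.
  rewrite mem_cat => /orP[/IHp H|/IHq H] /H[K3 ->]; rewrite inE => H3; exists K3 => //; move: H3.
    by case/orP=> [/eqP ->|H3]; rewrite !inE mem_cat ?eqxx ?H3 ?orbT.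
  by case/orP=> [/eqP ->|H3]; rewrite !inE mem_cat ?eqxx ?H3 ?orbT.
case/orP=> [/eqP -> /=|].
  rewrite !inE => /orP[] /eqP[_ ->]; first by exists K; rewrite // mem_head.
  by exists [:: p, Star p & K]; rewrite // !inE conts_self !orbT.
move=> /IHp H /H[K3 ->]; rewrite inE => H3; exists K3 => //; move: H3.
by case/orP=> [/eqP ->|H3]; rewrite !inE ?eqxx ?H3 ?orbT.
Qed.

Definition reachable (p0 : prog) : seq state :=
  [:: None, Some [::] & map Some (conts p0 [::])].

Lemma reachable_closed p0 K o K' : K \in reachable p0 -> (o, K') \in moves p0 K ->
  K' \in reachable p0.
Proof.
have p0P : Some [:: p0] \in reachable p0.
  by rewrite !inE map_f ?orbT // conts_self.
rewrite !inE => /or3P[/eqP ->|/eqP ->|/mapP[K1 K1P ->]] /=.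
- by rewrite !inE => /orP[] /eqP[_ ->].
- by rewrite !inE => /or3P[] /eqP[_ ->] //; rewrite !inE in p0P.
move=> /(conts_closed K1P)[K3 -> ]; rewrite inE => /orP[/eqP ->|H] //.
by rewrite map_f ?orbT.
Qed.

(** * Executions of the main loop *)

Section Execution.
Variables (G : nat -> bool) (chi : formula).
Hypothesis chi_ex : existential chi.
Variable n : nat.

Section Sound.
Variables (st : nat -> state) (ops : nat -> op) (s : nat -> env).
Hypothesis st0 : st 0 = None.
Hypothesis s0 : s 0 = fun=> 0.
Hypothesis stS : forall i, (ops i, st i.+1) \in moves (body chi) (st i).
Hypothesis guardP : forall i, guard G (ops i) (s i).
Hypothesis sS : forall i, s i.+1 = exec (ops i) (s i).
Hypothesis exit_n : st n = None /\ ops n = Skip.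
Hypothesis marks : forall N, exists2 i, N <= i & is_mark (ops i).

(** Only [None] has a transition to [None], so loading at time n forces loading at all earlier
    times, and each step between two loading states is [Incr 0]. *)
Lemma loading i : i <= n -> st i = None /\ s i 0 = i /\ s i 1 = 0.
Proof.
have stN j : j <= n -> st (n - j) = None.
  elim: j => [|j IHj] jn; first by rewrite subn0; case: exit_n.
  have := stS (n - j.+1); have -> : (n - j.+1).+1 = n - j by lia.
  rewrite IHj 1?ltnW //; case: (st (n - j.+1)) => // -[|[o|p q|p q|p] K] /=;
    do ?[case: ifP => // _]; by rewrite ?inE ?xpair_eqE ?andbF.
elim: i => [|i IHi] i_n; first by rewrite st0 s0.
have [sti [si0 si1]] := IHi (ltnW i_n).
have stiS : st i.+1 = None by have := stN (n - i.+1) (leq_subr _ _); rewrite subKn.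
have := stS i; rewrite sti stiS !inE /= => /orP[] /eqP[] // opE.
by split=> //; rewrite sS opE /= /upd /= si0 si1.
Qed.

Fixpoint runs (K : seq prog) (s1 s2 : env) : Prop :=
  if K is p :: K' then exists2 s', run G p s1 s' & runs K' s' s2 else s1 = s2.

(** Induction on the length of the segment: a small step either executes an atom or unfolds the top
    program as the corresponding rule of [run] does, and idling leaves the registers unchanged. *)
Lemma segment i j K : i <= j -> (forall k, i <= k < j -> ~~ is_mark (ops k)) ->
  st i = Some K -> st j = Some [::] -> runs K (s i) (s j).
Proof.
move=> ij; have {ij}[m ->] : exists m, j = m + i by exists (j - i); lia.
elim: m i K => [|m IHm] i K nomark stK stj.
  by move: stj; rewrite add0n stK => -[->].
have {}IHm K' : st i.+1 = Some K' -> runs K' (s i.+1) (s (m.+1 + i)).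
  rewrite addSnnS => stK'; apply: IHm => //; last by rewrite -addSnnS.
  by move=> k /andP[ik kj]; apply: nomark; lia.
have nom : ~~ is_mark (ops i) by apply: nomark; lia.
have := stS i; have := guardP i; rewrite stK sS in IHm *.
case: K stK => [|[o|p q|p q|p] K] stK /=.
- move=> _; rewrite !inE => /or3P[] /eqP[opE stE]; rewrite opE // in nom.
  by have := IHm _ stE; rewrite opE.
- case: ifP => // _ go; rewrite inE => /eqP[oE stE]; rewrite oE in IHm go nom.
  by exists (exec o (s i)); [exact: run_atom|exact: IHm].
- move=> _; rewrite inE => /eqP[oE stE]; rewrite oE in IHm.
  have /= [s1 r1 [s2 r2 r3]] := IHm _ stE.
  by exists s2 => //; apply/run_seqE; exists s1.
- move=> _; rewrite !inE => /orP[] /eqP[oE stE]; rewrite oE in IHm;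
    have /= [s1 r1 r2] := IHm _ stE; exists s1 => //; apply/run_altE; by [left|right].
move=> _; rewrite !inE => /orP[] /eqP[oE stE]; rewrite oE in IHm; have /= := IHm _ stE.
  by exists (s i) => //; exact: run_star0.
by case=> s1 r1 [s2 r2 r3]; exists s2 => //; apply: run_starS r1 r2.
Qed.

Lemma mark_state i : is_mark (ops i) ->
  [/\ st i = Some [::], st i.+1 = Some [:: body chi] & s i.+1 = s i].
Proof.
rewrite sS; have := stS i; case: (st i) => [[|[o|p q|p q|p] K]|] /=; rewrite ?inE.
- by case/or3P=> /eqP[-> ->].
- by case: ifP => // no; rewrite inE => /eqP[-> _]; rewrite no.
- by case/eqP=> ->.
- by case/orP=> /eqP[->].
- by case/orP=> /eqP[->].
by case/orP=> /eqP[->].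
Qed.

Lemma next_mark i : exists2 j, i <= j & is_mark (ops j) /\
  forall k, i <= k < j -> ~~ is_mark (ops k).
Proof.
have exj : exists j, (i <= j) && is_mark (ops j).
  by have [j ij mj] := marks i; exists j; rewrite ij.
case: (ex_minnP exj) => j /andP[ij mj] minj; exists j => //; split=> // k /andP[ik kj].
by apply/negP=> mk; have := minj k; rewrite ik mk => /(_ isT); rewrite leqNgt kj.
Qed.

(** By induction on c there is a mark at which register 1 holds c; the segment up to the next mark
    is then a run of the body, which verifies instance c and increments the register. *)
Lemma execution_sound c : holds G [:: n; c] chi.
Proof.
suff [i [mi [si0 si1]]] : exists i, is_mark (ops i) /\ s i 0 = n /\ s i 1 = c.
  have [_ st1 s1] := mark_state mi; have [j ij [mj nomark]] := next_mark i.+1.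
  have [stj _ _] := mark_state mj; have /= [s' r _] := segment ij nomark st1 stj.
  by have [] := body_sound chi_ex r; rewrite s1 si0 si1.
elim: c => [|c [i [mi [si0 si1]]]].
  have [j nj [mj nomark]] := next_mark n.+1; have [stj _ _] := mark_state mj.
  have [stn opn] := exit_n; have stn1 : st n.+1 = Some [::].
    by have := stS n; rewrite stn opn !inE /= => /orP[] /eqP[].
  have /= E := segment nj nomark stn1 stj; exists j; rewrite -E sS opn /=.
  by have [_ [-> ->]] := loading (leqnn n).
have [_ st1 s1] := mark_state mi; have [j ij [mj nomark]] := next_mark i.+1.
have [stj _ _] := mark_state mj; have /= [s' r E] := segment ij nomark st1 stj.
by exists j; rewrite -E; have [_ -> ->] := body_sound chi_ex r; rewrite s1 si0 si1.
Qed.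

End Sound.

Section Complete.
Hypothesis holds_all : forall c, holds G [:: n; c] chi.

Record config := Config { cst : state; cenv : env; cclk : nat; cfill : int -> bool }.

Definition next_fill (o : op) (clk : nat) (fl : int -> bool) : int -> bool :=
  fun z => if is_mark o then (Posz (2 ^ clk) %| z)%Z else fl z || fl (z - 1)%R.

(** The clock will be the distance to the initial column; hence loading has to stop at clock n + 1,
    the place inspected by [fits_input]. *)
Definition cstep (x : config) (o : op) (y : config) : Prop :=
  [/\ (o, cst y) \in moves (body chi) (cst x), guard G o (cenv x),
      (is_mark o -> forall z, cfill x z),
      (cst x = None -> (o == Skip) = (cclk x == n.+1))
    & [/\ cenv y = exec o (cenv x), cclk y = (cclk x).+1
        & cfill y = next_fill o (cclk x) (cfill x)]].

Definition filled (N j : nat) (fl : int -> bool) : Prop :=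
  forall (z : int) (t : nat), t <= j -> (Posz (2 ^ N) %| (z - Posz t)%R)%Z -> fl z.

Lemma filled_step N j o clk fl : ~~ is_mark o -> filled N j fl ->
  filled N j.+1 (next_fill o clk fl).
Proof.
move=> /negPf nom fillj z t; rewrite /next_fill nom leq_eqVlt => /orP[/eqP ->|tj] dvd.
  by rewrite (fillj (z - 1)%R j) ?orbT //; move: dvd; congr (_ %| _)%Z; lia.
by rewrite (fillj z t).
Qed.

Lemma filled_weaken N i j fl : i <= j -> filled N j fl -> filled N i fl.
Proof. by move=> ij fillj z t ti; apply: fillj; apply: leq_trans ij. Qed.

Lemma filled_all N j fl : 2 ^ N <= j -> filled N j fl -> forall z, fl z.
Proof.
move=> Nj fillj z; have N0 : Posz (2 ^ N) != 0%R by rewrite -lt0n expn_gt0.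
apply: (fillj z (absz (z %% Posz (2 ^ N))%Z)).
  have := ltz_mod z N0; have := modz_ge0 z N0; lia.
rewrite gez0_abs ?modz_ge0 //; apply/dvdzP; exists (z %/ Posz (2 ^ N))%Z.
by have := divz_eq z (Posz (2 ^ N)); lia.
Qed.

Definition restart (x : config) : Prop :=
  [/\ cst x = Some [:: body chi], cenv x 0 = n, n.+1 < cclk x
    & exists N, filled N 0 (cfill x)].

Inductive reaches (b : bool) : config -> Prop :=
| reaches_mark x y : cstep x (Mark b) y -> restart y -> reaches b x
| reaches_step x o y : cstep x o y -> reaches b y -> reaches b x.

Lemma reaches_skip b K K' s clk fl : n.+1 < clk ->
  (Skip, Some K') \in moves (body chi) (Some K) ->
  reaches b (Config (Some K') s clk.+1 (next_fill Skip clk fl)) ->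
  reaches b (Config (Some K) s clk fl).
Proof. by move=> nclk mv; apply: (@reaches_step _ _ Skip); split. Qed.

(** From a flood containing the multiples of 2^N, at most 2^N idle steps fill the line, no matter
    how far the clock advances meanwhile. Then a mark of either kind is allowed. *)
Lemma reaches_wait b s clk fl N j : n.+1 < clk -> s 0 = n -> filled N j fl ->
  reaches b (Config (Some [::]) s clk fl).
Proof.
move=> + s0; have [m] : exists m, 2 ^ N <= j + m by exists (2 ^ N); lia.
elim: m j clk fl => [|m IHm] j clk fl jm nclk fillj.
  apply: (@reaches_mark _ _ (Config (Some [:: body chi]) s clk.+1 (next_fill (Mark b) clk fl))).
    split=> //; first by case: b; rewrite !inE !eqxx ?orbT.
    by move=> _; apply: filled_all fillj; lia.
  split=> //=; first by lia.
  by exists clk => z t; rewrite leqn0 => /eqP -> ; rewrite GRing.subr0 /next_fill.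
apply: (reaches_skip (K' := [::])) => //; first by rewrite mem_head.
apply: (IHm j.+1); [lia|lia|].
exact: filled_step.
Qed.

(** A run is replayed on top of an arbitrary stack, in continuation form. The modulus N of the flood
    stays fixed while the clock and the flood grow. *)
Lemma reaches_run b p s s' : run G p s s' -> forall K N,
  (forall clk fl, n.+1 < clk -> filled N 0 fl -> reaches b (Config (Some K) s' clk fl)) ->
  forall clk fl, n.+1 < clk -> filled N 0 fl ->
  reaches b (Config (Some (p :: K)) s clk fl).
Proof.
have fillS N o clk fl : ~~ is_mark o -> filled N 0 fl -> filled N 0 (next_fill o clk fl).
  by move=> nom /(filled_step clk nom); exact: filled_weaken.
have clkS clk : n.+1 < clk -> n.+1 < clk.+1 by lia.
elim=> {p s s'} [o s nom go|p q s1 s2 s3 _ IHp _ IHq|p q s s' _ IHp|p q s s' _ IHq|p s|p s1 s2 s3 _ IHp _ IHs]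
  K N Kr clk fl nclk fillN.
- apply: (@reaches_step _ _ o (Config (Some K) (exec o s) clk.+1 (next_fill o clk fl))).
    split=> //=; first by rewrite (negPf nom) inE.
    by rewrite (negPf nom).
  by apply: Kr; [exact: clkS|exact: fillS].
- apply: (reaches_skip (K' := [:: p, q & K])) => //; first by rewrite inE.
  by apply: (IHp (q :: K) N); [exact: IHq|exact: clkS|exact: fillS].
- apply: (reaches_skip (K' := p :: K)) => //; first by rewrite mem_head.
  by apply: IHp Kr _ _ _ _; [exact: clkS|exact: fillS].
- apply: (reaches_skip (K' := q :: K)) => //; first by rewrite !inE eqxx orbT.
  by apply: IHq Kr _ _ _ _; [exact: clkS|exact: fillS].
- apply: (reaches_skip (K' := K)) => //; first by rewrite mem_head.
  by apply: Kr; [exact: clkS|exact: fillS].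
apply: (reaches_skip (K' := [:: p, Star p & K])) => //; first by rewrite !inE eqxx orbT.
by apply: (IHp (Star p :: K) N); [exact: IHs|exact: clkS|exact: fillS].
Qed.

Lemma reaches_restart b x : restart x -> reaches b x.
Proof.
case: x => st s clk fl [/= -> s0 nclk [N fillN]].
have [|s' r] := @body_complete G chi s chi_ex; first by rewrite s0.
apply: (reaches_run r (N := N)) => // clk' fl' nclk' fillN'.
by apply: reaches_wait fillN' => //; have [_ -> _] := body_sound chi_ex r.
Qed.

Lemma reaches_start b : reaches b (Config None (fun=> 0) 1 (fun=> true)).
Proof.
suff load m s : m <= n -> s 0 = n - m ->
    reaches b (Config None s (n - m).+1 (fun=> true)).
  by have := load n (fun=> 0) (leqnn n); rewrite subnn; exact.
elim: m s => [|m IHm] s mn s0; rewrite ?subn0 in s0 *.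
  apply: (@reaches_step _ _ Skip (Config (Some [::]) s n.+2 (fun=> true))).
    split=> //=; first by rewrite !inE eqxx orbT.
    by rewrite !eqxx.
  by apply: (@reaches_wait b s _ _ 0 0) => //; rewrite ?s0 ?subn0 //; lia.
apply: (@reaches_step _ _ (Incr 0) (Config None (exec (Incr 0) s) (n - m).+1 (fun=> true))).
  split=> //=; first by rewrite !inE eqxx.
    have -> : (Incr 0 == Skip) = false by apply/eqP.
    by move=> _; apply/esym/eqP; lia.
  by split=> //; lia.
by apply: IHm; [exact: ltnW|rewrite /= /upd /= s0; lia].
Qed.

(** The explicit distance to the mark gives a decreasing counter, so that steps picked by choice do
    arrive at the mark instead of postponing it forever. *)
Fixpoint reaches_in (b : bool) (k : nat) (x : config) : Prop :=
  if k is k'.+1 then exists o y, cstep x o y /\ reaches_in b k' y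
  else exists2 y, cstep x (Mark b) y & restart y.

Lemma reaches_inP b x : reaches b x -> exists k, reaches_in b k x.
Proof.
elim=> [{}x y xy ry|{}x o y xy _ [k yk]]; first by exists 0, y.
by exists k.+1, o, y.
Qed.

Definition pending : Type := {w : config * bool * nat | reaches_in w.1.2 w.2 w.1.1}.

Lemma pending_step (w : pending) : exists ow : op * pending,
  cstep (sval w).1.1 ow.1 (sval ow.2).1.1 /\
  if (sval w).2 is k.+1 then (sval ow.2).1.2 = (sval w).1.2 /\ (sval ow.2).2 = k
  else ow.1 = Mark (sval w).1.2 /\ (sval ow.2).1.2 = ~~ (sval w).1.2.
Proof.
case: w => -[[x b] [|k]] /= [o]; last by case=> y [xy yk]; exists (o, exist _ (y, b, k) yk).
move=> xo /(reaches_restart (~~ b))/reaches_inP[k ok].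
by exists (Mark b, exist _ (o, ~~ b, k) ok).
Qed.

(* The next mark is reached by decreasing the distance to it, and the two kinds
   of marks are requested alternately. *)
Lemma execution_complete : exists (u : nat -> config) (ops : nat -> op),
  [/\ u 0 = Config None (fun=> 0) 1 (fun=> true),
      forall i, cstep (u i) (ops i) (u i.+1)
    & forall b N, exists2 i, N <= i & ops i = Mark b].
Proof.
have [k0 start] := reaches_inP (reaches_start true).
have [nx nxP] := choice _ pending_step.
pose w i := iter i (fun w => (nx w).2) (exist _ (_, true, k0) start : pending).
exists (fun i => (sval (w i)).1.1), (fun i => (nx (w i)).1).
split=> [//|i|b N]; first by have [] := nxP (w i).
have mark i : exists j, [/\ i <= j, (nx (w j)).1 = Mark (sval (w i)).1.2
    & (sval (w j.+1)).1.2 = ~~ (sval (w i)).1.2].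
  move E: (sval (w i)).2 => k; elim: k i E => [|k IHk] i E.
    by have [_] := nxP (w i); rewrite E => -[]; exists i.
  have [_] := nxP (w i); rewrite E => -[bE kE].
  have [j [ij Mj bj]] := IHk i.+1 kE; exists j.
  by split; [exact: ltnW|rewrite Mj /= bE|rewrite bj /= bE].
have [j [Nj Mj bj]] := mark N.
have [bN|bN] := eqVneq b (sval (w N)).1.2; first by exists j; rewrite ?bN.
have [j' [jj' Mj' _]] := mark j.+1; exists j'; first by lia.
by rewrite Mj' bj; move: bN; case: (b); case: (_.1.2).
Qed.

End Complete.
End Execution.

Import Order.TTheory GRing.Theory Num.Theory.
Local Open Scope ring_scope.

(** * Periodic subsets of the integers *)

Lemma int_const (T : Type) (f : int -> T) :
  (forall z, f (z + 1) = f z) -> forall z, f z = f 0.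
Proof.
move=> fS; elim/int_ind => [//|n IHn|n IHn]; first by rewrite -addn1 PoszD fS.
by rewrite -IHn -[in RHS](subrK 1 (- n%:Z)) fS; congr f; lia.
Qed.

Lemma const_interval (f : int -> bool) (o : int) (N : nat) :
  (forall k : nat, (k < N)%N -> f (o + k%:Z + 1) = f (o + k%:Z)) ->
  forall k : nat, (k <= N)%N -> f (o + k%:Z) = f o.
Proof.
move=> fS; elim=> [|k IHk] kN; first by rewrite addr0.
by rewrite -addn1 PoszD addrA fS // IHk // ltnW.
Qed.

Definition mult (N : nat) (o : int) : int -> bool := fun z => (N%:Z %| z - o)%Z.

Definition toggles (h f : int -> bool) : Prop := forall z, h (z + 1) = h z (+) f z.

Lemma mult_self N o : mult N o o.
Proof. by rewrite /mult subrr dvdz0. Qed.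

Lemma multP N o z : reflect (exists k, z = o + k * N%:Z) (mult N o z).
Proof.
apply: (iffP dvdzP) => -[k E]; exists k; lia.
Qed.

Lemma mult_add N o k : mult N o (o + k * N%:Z).
Proof. by apply/multP; exists k. Qed.

Lemma mult_between N o (k : int) (r : nat) : (0 < r < N)%N -> mult N o (o + k * N%:Z + r%:Z) = false.
Proof.
move=> rN; apply/negP => /multP[q E]; have {}E : (q - k) * N%:Z = r%:Z by lia.
by have [] := lerP (q - k) 0 => ?; nia.
Qed.

Lemma mult_toggles N o h (k : int) : (0 < N)%N -> toggles h (mult N o) ->
  h (o + (k + 1) * N%:Z) = ~~ h (o + k * N%:Z).
Proof.
move=> N0 hm; have hS : h (o + k * N%:Z + 1) = ~~ h (o + k * N%:Z).
  by rewrite hm mult_add addbT.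
rewrite -hS; have -> : o + (k + 1) * N%:Z = o + k * N%:Z + 1 + (N.-1)%:Z by lia.
apply: (const_interval (N := N.-1)) => // r rN; rewrite hm.
have -> : o + k * N%:Z + 1 + r%:Z = o + k * N%:Z + r.+1%:Z by lia.
by rewrite mult_between ?addbF //; lia.
Qed.

Lemma mult_toggles_even N o h (q : int) : (0 < N)%N -> toggles h (mult N o) ->
  h (o + q * (2 * N)%:Z) = h o.
Proof.
move=> N0 hm.
rewrite [RHS](_ : h o = h (o + 0 * (2 * N)%:Z)); last by rewrite mul0r addr0.
apply: (int_const (f := fun q => h (o + q * (2 * N)%:Z))) => {}q.
have -> : o + (q + 1) * (2 * N)%:Z = o + (q * 2 + 1 + 1) * N%:Z by lia.
by rewrite !mult_toggles // negbK; congr h; lia.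
Qed.

(** The switch [h] is constant in the gaps of the coset and changes at each of its points, so it is
    on at every second one; its value at [o] tells which half survives. *)
Lemma mult_double N o h : (0 < N)%N -> toggles h (mult N o) -> h o ->
  forall z, mult N o z && h z = mult (2 * N) o z.
Proof.
move=> N0 hm ho z; apply/andP/multP => [[/multP[k ->]]|[q ->]].
  have [q [kE|kE]] : exists q, k = 2 * q \/ k = 2 * q + 1.
    by exists (k %/ 2)%Z; have := divz_eq k 2; have := ltz_mod k (d := 2) isT;
      have := modz_ge0 k (d := 2) isT; lia.
    by move=> _; exists q; rewrite kE; lia.
  rewrite kE mult_toggles // (_ : 2 * q * N%:Z = q * (2 * N)%:Z); last by lia.
  by rewrite mult_toggles_even // ho.
split; last by rewrite mult_toggles_even.
by apply/multP; exists (q * 2); lia.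
Qed.

Definition spaced (N : nat) (f : int -> bool) : Prop := exists o, f =1 mult N o.

Lemma toggles_ext h f g : f =1 g -> toggles h f -> toggles h g.
Proof. by move=> fg hf z; rewrite hf fg. Qed.

Lemma spaced_full (f : int -> bool) : (forall z, f z) -> spaced 1 f.
Proof. by move=> f1; exists 0 => z; rewrite f1 /mult dvd1z. Qed.

Lemma spaced_double N f h : (0 < N)%N -> spaced N f -> toggles h f ->
  spaced (2 * N) (fun z => f z && h z).
Proof.
move=> N0 [o fE] /(toggles_ext fE) hf; case ho : (h o).
  by exists o => z; rewrite fE mult_double.
exists (o + N%:Z) => z.
have fE' : mult N o =1 mult N (o + N%:Z).
  by move=> t; apply/multP/multP => -[k ->]; [exists (k - 1)|exists (k + 1)]; lia.
rewrite fE fE' mult_double //; first exact: toggles_ext hf.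
by have := mult_toggles 0 N0 hf; rewrite add0r mul1r mul0r addr0 ho.
Qed.

Lemma spaced_period N f z k : spaced N f -> f (z + k * N%:Z) = f z.
Proof.
case=> o fE; rewrite !fE; apply/multP/multP => -[q E]; [exists (q - k)|exists (q + k)]; lia.
Qed.

(** This makes [Test] sound: a coset determines its modulus, as two neighbouring points of one coset
    differ by a multiple of the other modulus. *)
Lemma spaced_inj N M f g : (0 < N)%N -> (0 < M)%N -> spaced N f -> spaced M g ->
  f =1 g -> N = M.
Proof.
move=> N0 M0 [o fE] [o' gE] fg.
have step A B a b : (0 < A)%N -> (0 < B)%N -> mult A a =1 mult B b -> (B <= A)%N.
  move=> A0 B0 E; have := mult_self A a; have := mult_add A a 1; rewrite !E.
  move=> /multP[k Ek] /multP[k' Ek'].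
  have {Ek Ek'}E' : A%:Z = (k - k') * B%:Z by lia.
  by have [] := lerP (k - k') 0 => ?; nia.
by apply/eqP; rewrite eqn_leq (step M N o' o) ?(step N M o o') // => z;
  rewrite -gE -fE fg.
Qed.

(* [i] ranges over all of Z here: this is what happens to the clocks of a tiling
   without initial column. *)
Lemma eternal_doubling (f h : int -> int -> bool) :
  (forall i, toggles (h i) (f i)) ->
  (forall i z, f (i + 1) z = f i z && h i z) ->
  forall i z z', f i z -> f i z' -> z = z'.
Proof.
move=> hf fS.
(* Induction on a bound for the distance, going one step into the past. Both points survived with
   the switch on, but it is off just after the first one; so the preceding column has a further
   point strictly between them. *)
have noclose D : forall i z (k : nat), (0 < k <= D)%N -> f i z -> f i (z + k%:Z) -> False.
  elim: D => [|D IHD] i z k kD fz fz'; first by lia.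
  move: fz fz'; rewrite -(subrK 1 i) !fS => /andP[fz hz] /andP[fz' hz'].
  set i' := i - 1 in fz hz fz' hz'.
  have hz1 : h i' (z + 1) = false by rewrite hf fz hz.
  have [r rk fr] : exists2 r : nat, (0 < r < k)%N & f i' (z + r%:Z).
    apply: NNPP => nor; suff : h i' (z + k%:Z) = false by rewrite hz'.
    rewrite -hz1 (_ : z + k%:Z = z + 1 + k.-1%:Z); last by lia.
    apply: (const_interval (N := k.-1)) => // r rk; rewrite hf.
    case E : (f i' _); last by rewrite addbF.
    case: nor; exists r.+1; first by lia.
    by move: E; rewrite (_ : z + 1 + r%:Z = z + r.+1%:Z) //; lia.
  by apply: (IHD i' z r) => //; lia.
move=> i z z' fz fz'; case: (ltgtP z z') => // zz'.
  by case: (noclose (absz (z' - z)) i z (absz (z' - z))) => //; [lia|rewrite (_ : z + _ = z') //; lia].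
by case: (noclose (absz (z - z')) i z' (absz (z - z'))) => //; [lia|rewrite (_ : z' + _ = z) //; lia].
Qed.

(** * The tiles *)

Definition transition : Type := (state * (op * state))%type.

Definition transitions (p0 : prog) : seq transition :=
  [seq (K, ok) | K <- reachable p0, ok <- moves p0 K].

Lemma transitionsP p0 (t : transition) :
  t \in transitions p0 <-> t.1 \in reachable p0 /\ t.2 \in moves p0 t.1.
Proof.
split=> [/allpairsPdep[K [ok [KR okK ->]]]//|[KR okK]].
by apply/allpairsPdep; exists t.1, t.2; split=> //; case: t {KR okK}.
Qed.

Definition registers (o : op) : seq nat :=
  match o with
  | Reset x | Incr x | Look x _ => [:: x]
  | Test x y => [:: x; y]
  | _ => [::]
  end.

Definition max_register (p0 : prog) : nat :=
  (\max_(x <- flatten [seq registers t.2.1 | t <- transitions p0]) x)%N.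

Lemma register_bound p0 t x : t \in transitions p0 -> x \in registers t.2.1 ->
  (x <= max_register p0)%N.
Proof.
move=> tP xt; apply: (@leq_bigmax_seq _ _ xpredT (fun x => x)) => //.
by apply/flattenP; exists (registers t.2.1) => //; exact: (map_f (fun t : transition => registers t.2.1)).
Qed.

(* [lab] is [None] before the initial column, [Some true] on it and
   [Some false] after it.  The value v of a register, and that of the two
   clocks, is coded by a set of marks that is a coset of 2^v Z; an auxiliary bit
   switches its value after each mark. *)
Record tile (p0 : prog) : Type := Tile {
  lab : option bool;
  trn : 'I_(size (transitions p0));
  reg : {ffun 'I_(max_register p0).+1 -> bool};
  reg_aux : {ffun 'I_(max_register p0).+1 -> bool};
  clk1 : bool; clk1_aux : bool;
  clk2 : bool; clk2_aux : bool;
  orc : bool;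
  fill : bool; fill_prev : bool;
  free : bool
}.

Section Tile.
Variable p0 : prog.
Local Notation tile := (tile p0).

Definition tile_code (a : tile) :=
  (lab a, trn a, reg a, reg_aux a, (clk1 a, clk1_aux a, clk2 a, clk2_aux a),
   (orc a, fill a, fill_prev a, free a)).

Definition tile_decode u : tile :=
  let: (l, t, r, ra, (a, b, c, d), (o, f, fp, fr)) := u in
  Tile l t r ra a b c d o f fp fr.

Lemma tile_codeK : cancel tile_code tile_decode. Proof. by case. Qed.

HB.instance Definition _ := Finite.copy tile (can_type tile_codeK).

Implicit Types a b : tile.

Definition tile_transition a : transition := tnth (in_tuple (transitions p0)) (trn a).
Definition source a : state := (tile_transition a).1.
Definition target a : state := (tile_transition a).2.2.
Definition action a : op := (tile_transition a).2.1.

Definition mark_kind (k : bool) a : bool := (lab a == Some false) && (action a == Mark k).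

Definition visible a : bool * bool :=
  (free a, mark_kind true a && clk2 a || mark_kind false a && clk1 a).

Definition next_reg o (r h : {ffun 'I_(max_register p0).+1 -> bool}) :=
  [ffun x => match o with
             | Reset y => (x == inord y) || r x
             | Incr y => if x == inord y then r x && h x else r x
             | _ => r x
             end].

(** The points of a register that its auxiliary bit would erase form the coset of v minus that of v
    + 1: there the oracle must show the guessed bit. Since every cell of a column is tested, a mark
    requires the flood to be complete. *)
Definition test_ok a : bool :=
  match action a with
  | Test x y => reg a (inord x) == reg a (inord y)
  | Look x b => (reg a (inord x) && ~~ reg_aux a (inord x)) ==> (orc a == b)
  | Mark _ => fill a
  | _ => true
  end.

(** The bi-infinite label sequences that this allows are constantly [None], constantly [Some false],
    or contain [Some true] exactly once. *)
Definition next_lab (l l' : option bool) : bool :=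
  match l, l' with
  | None, None | None, Some true | Some _, Some false => true
  | _, _ => false
  end.

(* Compatibility in the direction of time; the coherence condition relating
   [clk1] to the registers fixes the cosets up to the precision of the clock. *)
Definition fits0 a b : bool :=
  [&& orc a == orc b, next_lab (lab a) (lab b),
      (lab b == Some true) ==> clk1 b && clk2 b,
      (lab a != None) ==> (clk1 b == clk1 a && clk1_aux a)
                           && (clk2 b == clk2 a && clk2_aux a),
      (lab a == Some true) ==> (source b == None) && (reg b == [ffun=> true])
    & (lab a == Some false) ==>
      [&& target a == source b, reg b == next_reg (action a) (reg a) (reg_aux a),
          test_ok a, clk1 a ==> [forall x, reg a x && reg_aux a x]
        & fill b ==> if is_mark (action a) then clk1 a else fill a || fill_prev a]].

(** [fill_prev] copies the left neighbour, so that the spreading of the flood becomes a condition on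
    two cells adjacent in time. The bits [reg] and [clk1] may vary here; that they form cosets
    follows by induction on time. *)
Definition fits1 a b : bool :=
  [&& lab a == lab b, trn a == trn b, clk2 a == clk2 b, clk2_aux a == clk2_aux b,
      free a == free b, reg_aux b == [ffun x => reg_aux a x (+) reg a x],
      clk1_aux b == clk1_aux a (+) clk1 a & fill_prev b == fill a].

Definition fits2 a b : bool :=
  [&& (lab a, trn a, reg a, reg_aux a) == (lab b, trn b, reg b, reg_aux b),
      (clk1 a, clk1_aux a, orc a) == (clk1 b, clk1_aux b, orc b),
      (fill a, fill_prev a, free a) == (fill b, fill_prev b, free b)
    & clk2_aux b == clk2_aux a (+) clk2 a].

Definition unfree a : tile :=
  Tile (lab a) (trn a) (reg a) (reg_aux a) (clk1 a) (clk1_aux a) (clk2 a)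
    (clk2_aux a) (orc a) (fill a) (fill_prev a) false.

Definition fits_rest a b : bool := unfree a == unfree b.

Definition fits (j : nat) : tile -> tile -> bool :=
  match j with
  | 0 => fits0
  | 1 => fits1
  | 2 => fits2
  | _ => fits_rest
  end.

(* Imposed at distance [n.+1] in the direction of time, to load the input [n]. *)
Definition fits_input a b : bool :=
  (lab a == Some true) ==> (tile_transition b == (None, (Skip, Some [::]))).

End Tile.

(** * From an aperiodic tiling to a second-order witness *)

Section Soundness.
Variables (chi : formula) (n : nat).
Hypothesis chi_ex : existential chi.
Local Notation p0 := (body chi).
Variable c : int -> int -> int -> tile p0.
Hypothesis c0 : forall i z w, fits0 (c i z w) (c (i + 1) z w).
Hypothesis c1 : forall i z w, fits1 (c i z w) (c i (z + 1) w).
Hypothesis c2 : forall i z w, fits2 (c i z w) (c i z (w + 1)).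
Hypothesis c_input : forall i z w, fits_input (c i z w) (c (i + n.+1%:Z) z w).
(** [broken1] provides a mark of kind [false]. [broken2] provides one of kind [true] and, applied to
    powers of 2, makes marks recur. *)
Hypothesis broken1 : exists i z w, (visible (c i (z + 1) w)).2 <> (visible (c i z w)).2.
Hypothesis broken2 : forall k : nat, (0 < k)%N ->
  exists i z w, (visible (c i z (w + k%:Z))).2 <> (visible (c i z w)).2.

Let L i := lab (c i 0 0).
Let T i := tile_transition (c i 0 0).
Let clk i z := clk1 (c i z 0).
Let clka i z := clk1_aux (c i z 0).
Let clk' i w := clk2 (c i 0 w).
Let clka' i w := clk2_aux (c i 0 w).
Let R i x z := reg (c i z 0) x.
Let Ra i x z := reg_aux (c i z 0) x.
Let F i z := fill (c i z 0).
Let Fp i z := fill_prev (c i z 0).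
Let O z := orc (c 0 z 0).

Let labE i z w : lab (c i z w) = L i.
Proof.
rewrite /L (int_const (f := fun w => lab (c i z w))).
  by rewrite (int_const (f := fun z => lab (c i z 0))) // => {}z;
    have /and5P[/eqP ->] := c1 i z 0.
by move=> {}w; have /and4P[/eqP[-> _ _ _] _ _ _] := c2 i z w.
Qed.

Let trnE i z w : tile_transition (c i z w) = T i.
Proof.
rewrite /T /tile_transition (int_const (f := fun w => trn (c i z w))).
  by rewrite (int_const (f := fun z => trn (c i z 0))) // => {}z;
    have /and5P[_ /eqP ->] := c1 i z 0.
by move=> {}w; have /and4P[/eqP[_ -> _ _] _ _ _] := c2 i z w.
Qed.

Let clkE i z w : clk1 (c i z w) = clk i z.
Proof.
rewrite /clk (int_const (f := fun w => clk1 (c i z w))) // => {}w.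
by have /and4P[_ /eqP[-> _ _] _ _] := c2 i z w.
Qed.

Let clkE' i z w : clk2 (c i z w) = clk' i w.
Proof.
rewrite /clk' (int_const (f := fun z => clk2 (c i z w))) // => {}z.
by have /and5P[_ _ /eqP -> _ _] := c1 i z w.
Qed.

Let OE i z w : orc (c i z w) = O z.
Proof.
rewrite /O (int_const (f := fun w => orc (c i z w))).
  by rewrite (int_const (f := fun i => orc (c i z 0))) // => {}i;
    have /and5P[/eqP ->] := c0 i z 0.
by move=> {}w; have /and4P[_ /eqP[_ _ ->] _ _] := c2 i z w.
Qed.

Let clk_toggles i : toggles (clka i) (clk i).
Proof. by move=> z; have /and5P[_ _ _ _ /and4P[_ _ /eqP ? _]] := c1 i z 0. Qed.

Let clk_toggles' i : toggles (clka' i) (clk' i).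
Proof. by move=> w; have /and4P[_ _ _ /eqP] := c2 i 0 w. Qed.

Let R_toggles i x : toggles (Ra i x) (R i x).
Proof.
by move=> z; have /and5P[_ _ _ _ /and4P[_ /eqP E _ _]] := c1 i z 0; rewrite /Ra E ffunE.
Qed.

Let FpE i z : Fp i (z + 1) = F i z.
Proof. by have /and5P[_ _ _ _ /and4P[_ _ _ /eqP]] := c1 i z 0. Qed.

Let act i := (T i).2.1.

Let mark_kindE b i z w : mark_kind b (c i z w) = (L i == Some false) && (act i == Mark b).
Proof. by rewrite /mark_kind labE /action trnE. Qed.

Let visibleE i z w : (visible (c i z w)).2 =
  (L i == Some false) && ((act i == Mark true) && clk' i w
                          || (act i == Mark false) && clk i z).
Proof. by rewrite /visible /= !mark_kindE clkE clkE'; case: (_ == Some _). Qed.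

Let time i z : fits0 (c i z 0) (c (i + 1) z 0) := c0 i z 0.

Let clkS i z : L i != None -> clk (i + 1) z = clk i z && clka i z.
Proof.
move=> Li; have /and5P[_ _ _ /implyP + _] := time i z.
by rewrite labE => /(_ Li)/andP[/eqP E _]; exact: E.
Qed.

Let clkS' i w : L i != None -> clk' (i + 1) w = clk' i w && clka' i w.
Proof.
move=> Li; have /and5P[_ _ _ /implyP + _] := c0 i 0 w.
by rewrite labE => /(_ Li)/andP[_ /eqP E]; exact: E.
Qed.

Let labS i : next_lab (L i) (L (i + 1)).
Proof. by have /and5P[_] := time i 0. Qed.

Let L_next i : L i != None -> L (i + 1) = Some false.
Proof. by have := labS i; case: (L i) => // a; case: (L _) => // -[]. Qed.

Let clk_seed i z : L i = Some true -> clk i z.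
Proof.
move=> Li; have /and5P[_ _ /implyP + _ _] := time (i - 1) z.
by rewrite subrK -/(L i) labE Li eqxx => /(_ isT)/andP[].
Qed.

Let clk_seed' i w : L i = Some true -> clk' i w.
Proof.
move=> Li; have /and5P[_ _ /implyP + _ _] := c0 (i - 1) 0 w.
by rewrite subrK labE Li eqxx => /(_ isT)/andP[].
Qed.

Let seed_next i : L i = Some true ->
  (T (i + 1)).1 = None /\ forall x z, R (i + 1) x z.
Proof.
move=> Li; split=> [|x z].
  have /and5P[_ _ _ _ /andP[/implyP + _]] := time i 0.
  by rewrite -/(L i) Li => /(_ isT)/andP[/eqP].
have /and5P[_ _ _ _ /andP[/implyP + _]] := time i z.
by rewrite labE Li => /(_ isT)/andP[_ /eqP E]; rewrite /R E ffunE.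
Qed.

Let right_step i z : L i = Some false ->
  [/\ (T i).2.2 = (T (i + 1)).1,
      forall x, R (i + 1) x z = next_reg (act i) (reg (c i z 0)) (reg_aux (c i z 0)) x,
      test_ok (c i z 0), clk i z -> forall x, R i x z && Ra i x z
    & F (i + 1) z -> if is_mark (act i) then clk i z else F i z || Fp i z].
Proof.
move=> Li; have /and5P[_ _ _ _ /andP[_ /implyP]] := time i z.
rewrite labE Li => /(_ isT); rewrite /target /source /action !trnE -/(act i).
case/and5P=> /eqP st /eqP rg tst coh fl; split=> //.
- by move=> x; rewrite /R rg.
- by move=> /(implyP coh)/forallP.
exact: (implyP fl).
Qed.

Let exists_mark k : exists i, L i = Some false /\ act i = Mark k.
Proof.
case: k; last first.
  have [i [z [w]]] := broken1; rewrite !visibleE => ne; exists i.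
  by move: ne; do 3![case: eqP => // ?].
have [i [z [w]]] := @broken2 1 isT; rewrite !visibleE => ne; exists i.
by move: ne; do 3![case: eqP => // ?].
Qed.

Let mark_fill i z : L i = Some false -> is_mark (act i) -> F i z.
Proof.
move=> Li mi; have [_ _ + _ _] := right_step z Li.
by rewrite /test_ok /action trnE -/(act i); case: (act i) mi.
Qed.

Let no_two_marks : (forall i, L i = Some false) -> forall i (m : nat),
  is_mark (act i) -> is_mark (act (i + m.+1%:Z)) -> False.
Proof.
move=> Lr i m mi mm.
have one : forall z z', clk i z -> clk i z' -> z = z'.
  by move=> z z'; apply: (eternal_doubling clk_toggles) => j t; apply: clkS; rewrite Lr.
have exm : exists m : nat, is_mark (act (i + m.+1%:Z)) by exists m.
(* The next mark after i is taken, so that nothing restarts the flood in between. *)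
case: (ex_minnP exm) => {mm exm} {}m mm minm.
have filled_near r z : (r <= m)%N -> F (i + r.+1%:Z) z ->
    exists2 t : nat, (t <= r)%N & clk i (z - t%:Z).
  elim: r z => [|r IHr] z rm Fz.
    by have [_ _ _ _ /(_ Fz)] := right_step z (Lr i); rewrite mi; exists 0%N; rewrite ?subr0.
  move: Fz; rewrite (_ : i + r.+2%:Z = i + r.+1%:Z + 1); last by lia.
  have [_ _ _ _ + Fz] := right_step z (Lr (i + r.+1%:Z)); move=> /(_ Fz).
  case: ifP => [mr|_]; first by have := minm r mr; lia.
  rewrite -[z in Fp _ z](subrK 1) FpE => /orP[] /IHr[]; rewrite 1?ltnW // => t tr ct.
    by exists t => //; apply: ltnW.
  by exists t.+1 => //; move: ct; congr (clk i _); lia.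
have full z : exists2 t : nat, (t <= m)%N & clk i (z - t%:Z).
  by apply: filled_near => //; exact: mark_fill.
(* The clock points that flood cells 0 and m + 1 lie in [-m, 0] and [1, m + 1], so they are
   distinct. *)
have [t tm ct] := full 0; have [t' tm' ct'] := full (m.+1%:Z).
by have := one _ _ ct ct'; lia.
Qed.

(** Marks of both kinds occur, necessarily in different columns. Without an initial column the label
    [Some false] spreads to all times, and two marks are then impossible. *)
Let exists_seed : exists i, L i = Some true.
Proof.
apply: NNPP => noseed.
have [i [Li mi]] := exists_mark true; have [j [Lj mj]] := exists_mark false.
have Lr : forall k, L k = Some false.
  suff step k : L k = Some false -> L (k + 1) = Some false /\ L (k - 1) = Some false.
    move=> k; rewrite -(subrK i k) [k - i + i]addrC; move: (k - i).
    elim/int_ind => [|r|r]; rewrite ?addr0 // => /step[].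
      by rewrite -addrA -[r%:Z + 1]/(r + 1)%N%:Z addn1.
    by move=> _; congr (L _ = _); lia.
  move=> Lk; split; first by apply: L_next; rewrite Lk.
  have := labS (k - 1); rewrite subrK Lk; case Lk1 : (L (k - 1)) => [[]|] // _.
  by case: noseed; exists (k - 1).
have [ij|ij|ij] := ltrgtP i j.
- case: (@no_two_marks Lr i (absz (j - i - 1)%R)); rewrite ?mi //.
  by rewrite (_ : i + _ = j) ?mj //; lia.
- case: (@no_two_marks Lr j (absz (i - j - 1)%R)); rewrite ?mj //.
  by rewrite (_ : j + _ = i) ?mi //; lia.
by rewrite ij mj in mi.
Qed.

Lemma tiling_sound : exists G, forall k, holds G [:: n; k] chi.
Proof.
have [i0 Li0] := exists_seed.
pose col (k : nat) := i0 + k%:Z.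
have colS k : col k.+1 = col k + 1 by rewrite /col; lia.
have LS k : L (col k.+1) = Some false.
  elim: k => [|k IHk]; rewrite colS L_next //; last by rewrite IHk.
  by rewrite /col addr0 Li0.
have Lne k : L (col k) != None by case: k => [|k]; rewrite ?LS // /col addr0 Li0.
have clk_spaced k : spaced (2 ^ k) (clk (col k)).
  elim: k => [|k IHk]; first by apply: spaced_full => z; rewrite /col addr0 clk_seed.
  have [o oE] := spaced_double (expn_gt0 2 k) IHk (clk_toggles _).
  by exists o => z; rewrite colS clkS // oE expnS.
have clk_spaced' k : spaced (2 ^ k) (clk' (col k)).
  elim: k => [|k IHk]; first by apply: spaced_full => z; rewrite /col addr0 clk_seed'.
  have [o oE] := spaced_double (expn_gt0 2 k) IHk (clk_toggles' _).
  by exists o => z; rewrite colS clkS' // oE expnS.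
have [o oE] := choice _ clk_spaced.
(* Clock columns decrease with time, so a point of a later one belongs to all earlier ones. *)
have o_chain k k' : (k <= k')%N -> clk (col k) (o k').
  move=> /subnK <-; elim: (k' - k)%N {-2}k => [|r IHr] l.
    by rewrite add0n oE mult_self.
  by have := IHr l.+1; rewrite addnS -addSn colS clkS // => /andP[].
(* [o v.+1] is a clock point at time v + 1, hence in the coset of v + 1; moving by 2^v stays in the
   coset of v and leaves that of v + 1. *)
pose G v := O (o v.+1 + (2 ^ v)%:Z).
pose ops k := act (col k.+1); pose st k := (T (col k.+1)).1.
pose s := fix s k : env := if k is k'.+1 then exec (ops k') (s k') else fun=> 0%N.
have Ttr i : T i \in transitions p0 by rewrite /T /tile_transition mem_tnth.
have stS k : (ops k, st k.+1) \in moves p0 (st k).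
  have /transitionsP[_] := Ttr (col k.+1); rewrite /st /ops /act [col k.+2]colS.
  by have [<- _ _ _ _] := right_step 0 (LS k); case: (T _).2.
have in_bound k x : x \in registers (ops k) -> (x <= max_register p0)%N.
  exact: register_bound (Ttr _).
(* Values never exceed the time, so the clock is always precise enough to locate the cosets of v and
   v + 1. *)
have s_bound k x : (s k x <= k)%N.
  elim: k x => [//|k IHk] x /=; case: (ops k) => [y|y|? ?|? ?||?] /=; rewrite /upd;
    do ?[case: ifP => // _]; by rewrite ?ltnS // leqW.
have reg_spaced k (x : 'I_(max_register p0).+1) : spaced (2 ^ s k x) (R (col k.+1) x).
  elim: k x => [|k IHk] x.
    apply: spaced_full => z; have [_] := seed_next Li0.
    by rewrite (_ : i0 + 1 = col 1) //.
  have RS z : R (col k.+2) x z = next_reg (ops k) (reg (c (col k.+1) z 0))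
      (reg_aux (c (col k.+1) z 0)) x.
    by rewrite colS; have [_ -> _ _ _] := right_step z (LS k).
  have same : s k.+1 x = s k x ->
      (forall z, R (col k.+2) x z = R (col k.+1) x z) ->
      spaced (2 ^ s k.+1 x) (R (col k.+2) x).
    by move=> -> E; have [q qE] := IHk x; exists q => z; rewrite E qE.
  have inordE y : y \in registers (ops k) -> (x == inord y) = (x == y :> nat).
    by move=> /in_bound yM; rewrite -val_eqE /= inordK.
  move: RS same inordE; rewrite [s k.+1]/=.
  case: (ops k) => [y|y|y y'|y b||b] RS same inordE;
    try by apply: same => // z; rewrite RS ffunE.
    have [xy|xy] := eqVneq (x : nat) y; last first.
      by apply: same => [|z]; rewrite /= ?/upd ?RS ?ffunE ?inordE ?mem_head // (negPf xy).
    rewrite /= /upd xy eqxx expn0; apply: spaced_full => z.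
    by rewrite RS ffunE inordE ?mem_head // xy eqxx.
  have [xy|xy] := eqVneq (x : nat) y; last first.
    by apply: same => [|z]; rewrite /= ?/upd ?RS ?ffunE ?inordE ?mem_head // (negPf xy).
  rewrite /= /upd xy eqxx expnS -xy.
  have [q qE] := spaced_double (expn_gt0 2 _) (IHk x) (R_toggles _ _).
  by exists q => z; rewrite RS ffunE inordE ?mem_head // xy eqxx -xy -qE.
(* By coherence the clock point [o k.+1] lies in every register coset and in its halving, so both
   can be centred there. *)
have reg_mult k (x : 'I_(max_register p0).+1) :
    R (col k.+1) x =1 mult (2 ^ s k x) (o k.+1) /\
    (fun z => R (col k.+1) x z && Ra (col k.+1) x z) =1 mult (2 ^ (s k x).+1) (o k.+1).
  have /(_ x)/andP[Ro Rao] : forall x, R (col k.+1) x (o k.+1) && Ra (col k.+1) x (o k.+1).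
    by have [_ _ _ H _] := right_step (o k.+1) (LS k); apply: H; rewrite oE mult_self.
  have recenter N f z : spaced N f -> f z -> f =1 mult N z.
    move=> [q qE]; rewrite qE => /multP[r ->] t; rewrite qE.
    by apply/multP/multP => -[r' ->]; [exists (r' - r)|exists (r' + r)]; lia.
  split; first exact: recenter.
  apply: recenter; last by rewrite Ro.
  by rewrite expnS; apply: spaced_double => //; rewrite expn_gt0.
exists G; apply: (execution_sound chi_ex (st := st) (ops := ops) (s := s)) => //.
- by rewrite /st; have [] := seed_next Li0; rewrite (_ : i0 + 1 = col 1).
- move=> k; have := in_bound k.
  have tst z : test_ok (c (col k.+1) z 0) by have [] := right_step z (LS k).
  rewrite /guard; case opE : (ops k) => [y|y|y y'|y b||b] // bd.
    have eqR : R (col k.+1) (inord y) =1 R (col k.+1) (inord y').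
      move=> z; have := tst z.
      by rewrite /test_ok /action trnE -/(act _) -/(ops k) opE => /eqP.
    have := spaced_inj _ _ (reg_spaced k (inord y)) (reg_spaced k (inord y')) eqR.
    rewrite !inordK ?expn_gt0 ?ltnS ?bd ?inE ?eqxx ?orbT //.
    by move=> /(_ isT isT)/eqP; rewrite eqn_exp2l // => /eqP.
  rewrite /G; have := tst (o (s k y).+1 + (2 ^ s k y)%:Z).
  rewrite /test_ok /action trnE -/(act _) -/(ops k) opE OE => /implyP/(_ _)/eqP; apply.
  have [Rm Ram] := reg_mult k (inord y).
  rewrite inordK ?ltnS ?bd ?mem_head // in Rm Ram.
  have Om : mult (2 ^ (s k y).+1) (o (s k y).+1) (o k.+1).
    by rewrite -oE; apply: o_chain; rewrite ltnS s_bound.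
  have sh : (2 ^ (s k y).+1)%N%:Z = 2 * (2 ^ s k y)%:Z by rewrite expnS; lia.
  have N0 : (0 < 2 ^ s k y)%N by rewrite expn_gt0.
  have {Om}[q qE] := multP _ _ _ Om; rewrite sh in qE.
  set z := _ + _.
  have Rz : R (col k.+1) (inord y) z.
    by rewrite Rm; apply/multP; exists (1 - 2 * q); rewrite /z qE; lia.
  have -> : reg (c (col k.+1) z 0) (inord y) by exact: Rz.
  apply/negP => Raz; have : mult (2 ^ (s k y).+1) (o k.+1) z.
    by rewrite -Ram; apply/andP; split; [exact: Rz|exact: Raz].
  case/multP => r; rewrite /z qE sh; move: N0; set X := (2 ^ _)%N => X0 E.
  by have [] := lerP (q + r) 0 => ?; nia.
- suff E : T (col n.+1) = (None, (Skip, Some [::])) by rewrite /st /ops /act E.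
  have := c_input i0 0 0; rewrite /fits_input labE Li0 => /implyP/(_ isT)/eqP <-.
  by rewrite trnE.
(* Without marks from step N on, every column with a mark has index at most N. Its second clock has
   a period dividing 2^N, which contradicts [broken2] at 2^N. *)
move=> N; apply: NNPP => nomark.
have [i [z [w]]] := @broken2 (2 ^ N) (expn_gt0 2 N); apply.
rewrite !visibleE; case: eqP => //= Li; case: eqP => //= mi.
have before r : L (i0 - r.+1%:Z) = None.
  elim: r => [|r IHr]; [have := labS (i0 - 1)|have := labS (i0 - r.+2%:Z)].
    by rewrite subrK Li0; case: (L _).
  rewrite (_ : i0 - r.+2%:Z + 1 = i0 - r.+1%:Z); last by lia.
  by rewrite IHr; case: (L _).
have [k ik] : exists k : nat, i = col k.
  have [ii0|i0i] := ltrP i i0; last by exists (absz (i - i0)%R); rewrite /col; lia.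
  have := before (absz (i0 - i - 1)%R); rewrite (_ : i0 - _ = i) ?Li //; lia.
have kN : (k <= N)%N.
  case: k ik => // k ik; rewrite ltnNge; apply/negP => Nk; apply: nomark.
  by exists k => //; rewrite /ops -ik mi.
have -> : (2 ^ N)%N%:Z = (2 ^ (N - k))%N%:Z * (2 ^ k)%N%:Z.
  by rewrite -PoszM -expnD subnK.
by rewrite ik (spaced_period _ _ (clk_spaced' k)).
Qed.
End Soundness.

(** * From a second-order witness to a tiling *)

Section Complete.
Variables (chi : formula) (n : nat) (G : nat -> bool).
Hypothesis chi_ex : existential chi.
Hypothesis chi_holds : forall k, holds G [:: n; k] chi.
Local Notation p0 := (body chi).

Let D (v : nat) (z : int) : bool := ((2 ^ v)%N%:Z %| z)%Z.
(** An explicit switch for 2^v Z: modulo 2^(v+1) it is off on 1, ..., 2^v and on at the other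
    residues. Thus it changes just after each multiple of 2^v and is on at the multiples of
    2^(v+1). *)
Let H (v : nat) (z : int) : bool := (2 ^ v)%N%:Z <= ((z - 1) %% (2 ^ v.+1)%N%:Z)%Z.

Let pow_gt0 v : (0 < 2 ^ v)%N. Proof. by rewrite expn_gt0. Qed.

Let remainder v z : exists q r, [/\ z - 1 = q * (2 * (2 ^ v)%N%:Z) + r,
  0 <= r < 2 * (2 ^ v)%N%:Z & H v z = ((2 ^ v)%N%:Z <= r)].
Proof.
rewrite /H expnS PoszM; set M := Posz 2 * _.
have M0 : M != 0 by have := pow_gt0 v; rewrite /M; lia.
exists ((z - 1) %/ M)%Z, ((z - 1) %% M)%Z; split=> //; first exact: divz_eq.
by rewrite modz_ge0 // ltz_pmod // /M; have := pow_gt0 v; lia.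
Qed.

Let DP v z q r : z - 1 = q * (2 * (2 ^ v)%N%:Z) + r -> 0 <= r < 2 * (2 ^ v)%N%:Z ->
  D v z = (r + 1 == (2 ^ v)%N%:Z) || (r + 1 == 2 * (2 ^ v)%N%:Z).
Proof.
move=> zE rb; rewrite /D; apply/dvdzP/orP => [[k kE]|[]/eqP rE]; last 2 first.
- by exists (2 * q + 1); lia.
- by exists (2 * q + 2); lia.
have := pow_gt0 v; move: zE rb kE; set N := Posz _ => zE rb kE N0.
have rE : r + 1 = (k - 2 * q) * N by lia.
have [k1|k1] := ltrP (k - 2 * q) 1; first by nia.
have [k2|k2] := ltrP 2 (k - 2 * q); first by nia.
have [k3|k3] : k - 2 * q = 1 \/ k - 2 * q = 2 by lia.
  by left; apply/eqP; rewrite rE k3; lia.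
by right; apply/eqP; rewrite rE k3; lia.
Qed.

Let div_unique (M q r q' r' : int) : 0 <= r < M -> 0 <= r' < M ->
  q * M + r = q' * M + r' -> r = r'.
Proof.
move=> rM rM' E; have {}E : (q - q') * M = r' - r by lia.
have [l|l] := ltrP (q - q') 0; first by nia.
have [l'|l'] := ltrP 0 (q - q'); first by nia.
by have q0 : q - q' = 0 by [lia]; rewrite q0 in E; lia.
Qed.

Let H_toggles v : toggles (H v) (D v).
Proof.
move=> z; have [q [r [zE rb HE]]] := remainder v z.
have [q' [r' [zE' rb' ->]]] := remainder v (z + 1).
rewrite HE (DP zE rb); have N0 : 0 < (2 ^ v)%N%:Z by rewrite ltz_nat.
move: zE zE' rb rb' N0; set N := (2 ^ v)%N%:Z => zE zE' rb rb' N0.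
have [rl|rl] := ltrP (r + 1) (2 * N).
  have r'E : r' = r + 1 by apply: (@div_unique (2 * N) q' _ q); lia.
  by rewrite r'E; do 2![case: eqP => ?]; lia.
have r'0 : r' = 0 by apply: (@div_unique (2 * N) q' _ (q + 1)); lia.
by rewrite r'0; do 2![case: eqP => ?]; lia.
Qed.

Let DS v z : D v z && H v z = D v.+1 z.
Proof.
have [q [r [zE rb ->]]] := remainder v z; rewrite (DP zE rb).
rewrite /D expnS PoszM; have N0 : 0 < (2 ^ v)%N%:Z by rewrite ltz_nat.
move: zE rb N0; set N := (2 ^ v)%N%:Z => zE rb N0.
apply/idP/dvdzP => [rE|[k kE]].
  by exists (q + 1); move: rE; do 2![case: eqP => ?]; lia.
have -> : r = 2 * N - 1 by apply: (@div_unique (2 * N) q _ (k - 1)); lia.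
by rewrite subrK eqxx orbT; lia.
Qed.

Let D_le a b z : (a <= b)%N -> D b z -> D a z.
Proof. by move=> ab; apply: dvdz_trans; rewrite dvdzE /= dvdn_exp2l. Qed.

Let D0 v : D v 0. Proof. exact: dvdz0. Qed.

(** The 2-adic valuation of a nonzero z is the v for which z lies in 2^v Z but not in 2^(v+1) Z, the
    cells where [G v] is read. *)
Let g (z : int) : bool := G (logn 2 (absz z)).

Let gE v z : D v z -> ~~ H v z -> g z = G v.
Proof.
move=> Dz Hz; have : ~~ D v.+1 z by rewrite -DS Dz.
rewrite /g; move: Dz; rewrite /D !dvdzE /=.
case: (absz z) => [|m]; first by rewrite !dvdn0.
by rewrite !pfactor_dvdn // => vm /negP mv; congr G; lia.
Qed.

(** All cosets are centred at 0, so coherence amounts to the divisibility of powers of 2. The free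
    bit remains a parameter, to be chosen once all d coordinates are present. *)
Lemma tiling_complete : exists col : int -> int -> int -> bool -> tile p0,
  [/\ forall i z w fr fr', fits0 (col i z w fr) (col (i + 1) z w fr'),
      forall i z w fr, fits1 (col i z w fr) (col i (z + 1) w fr)
                       && fits2 (col i z w fr) (col i z (w + 1) fr),
      forall i z w fr fr', fits_input (col i z w fr) (col (i + n.+1%:Z) z w fr'),
      forall i z w fr, free (col i z w fr) = fr
      /\ unfree (col i z w fr) = unfree (col i z w false)
    & (forall k : int, k != 0 -> exists i, forall z,
        (visible (col i z k false)).2 <> (visible (col i 0 0 false)).2)
      /\ (forall k : int, k != 0 -> exists i, forall w,
        (visible (col i k w false)).2 <> (visible (col i 0 0 false)).2)].
Proof.
have [u [ops [u0 uS marks]]] := execution_complete chi_ex chi_holds.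
have clk_u k : cclk (u k) = k.+1.
  by elim: k => [|k IHk]; [rewrite u0|have [_ _ _ _ [_ -> _]] := uS k; rewrite IHk].
have reg_u k x : (cenv (u k) x <= k)%N.
  elim: k x => [|k IHk] x; first by rewrite u0.
  have [_ _ _ _ [-> _ _]] := uS k.
  case: (ops k) => [y|y|? ?|? ?||?] /=; rewrite /upd;
    do ?[case: ifP => // _]; by rewrite ?ltnS // leqW.
have reach k : cst (u k) \in reachable p0.
  elim: k => [|k IHk]; first by rewrite u0 mem_head.
  by have [mv _ _ _ _] := uS k; exact: reachable_closed mv.
have [idx idxE] : exists idx : nat -> 'I_(size (transitions p0)), forall k,
    tnth (in_tuple (transitions p0)) (idx k) = (cst (u k), (ops k, cst (u k.+1))).
  apply: (choice (fun k j => tnth (in_tuple (transitions p0)) j = _)) => k.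
  have /tnthP[j ->] : (cst (u k), (ops k, cst (u k.+1))) \in in_tuple (transitions p0).
    by apply/transitionsP; split; [exact: reach|have [] := uS k].
  by exists j.
pose M := max_register p0.
(* Column 0 is the initial one and column k + 1 shows the configuration [u k], whose clock is k + 1;
   negative columns carry only the oracle and the free bit. *)
pose col (i z w : int) (fr : bool) : tile p0 :=
  match i with
  | Negz _ => Tile None (idx 0%N) [ffun=> false] [ffun=> false] false false false false
                (g z) false false fr
  | Posz 0 => Tile (Some true) (idx 0%N) [ffun=> false] [ffun=> false] true (H 0 z)
                true (H 0 w) (g z) false false fr
  | Posz k.+1 => Tile (Some false) (idx k) [ffun x : 'I_M.+1 => D (cenv (u k) x) z]
                [ffun x : 'I_M.+1 => H (cenv (u k) x) z] (D k.+1 z) (H k.+1 z)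
                (D k.+1 w) (H k.+1 w) (g z) (cfill (u k) z) (cfill (u k) (z - 1)) fr
  end.
have D1 z : D 0 z = true by rewrite /D dvd1z.
have action_col k z w fr : action (col k.+1%:Z z w fr) = ops k.
  by rewrite /action /tile_transition /= idxE.
have in_bound k x : x \in registers (ops k) -> (x <= M)%N.
  have tP : (cst (u k), (ops k, cst (u k.+1))) \in transitions p0.
    by apply/transitionsP; split; [exact: reach|have [] := uS k].
  exact: register_bound tP.
exists col; split.
- move=> i z w fr fr'; case: i => [[|k]|[|k]]; last first.
  + by rewrite (_ : Negz k.+1 + 1 = Negz k); [rewrite /fits0 /= eqxx|lia].
  + by rewrite (_ : Negz 0 + 1 = 0); [rewrite /fits0 /= eqxx|lia].
  + rewrite (_ : k.+1%:Z + 1 = k.+2%:Z); last by lia.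
    have [mv go fl _ [envS _ fillS]] := uS k.
    rewrite /fits0 action_col /= eqxx /= !DS !eqxx /=; apply/and5P; split.
    * by rewrite /target /source /tile_transition /= !idxE.
    * apply/eqP/ffunP => x; rewrite !ffunE envS.
      have inordE y : y \in registers (ops k) -> (x == inord y) = (x == y :> nat).
        by move=> /in_bound yM; rewrite -val_eqE /= inordK.
      case: (ops k) inordE => [y|y|? ?|? ?||?] //= inordE; rewrite /upd inordE ?mem_head //;
        case: eqP => // ->; by rewrite ?D1 ?DS.
    * rewrite /test_ok action_col /=.
      case opE : (ops k) go fl => [y|y|y y'|y b||b] //= go fl; last exact: fl.
        by rewrite !ffunE !inordK ?ltnS ?(in_bound k) ?opE ?inE ?eqxx ?orbT ?go.
      rewrite !ffunE inordK ?ltnS ?(in_bound k) ?opE ?mem_head //.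
      by apply/implyP => /andP[Dz Hz]; rewrite (gE Dz Hz) go.
    * apply/implyP => Dz; apply/forallP => x; rewrite !ffunE DS.
      by apply: D_le Dz; rewrite ltnS.
    by apply/implyP; rewrite fillS /next_fill clk_u.
  rewrite add0r /fits0 /= !eqxx /= -!(DS 0) !D1 !eqxx /source /tile_transition /= idxE u0 eqxx /=.
  by rewrite andbT; apply/eqP/ffunP => x; rewrite !ffunE D1.
- move=> i z w fr; apply/andP; split; case: i => [[|k]|k].
  + rewrite /fits1 /= !eqxx /= H_toggles D1 eqxx !andbT.
    by apply/eqP/ffunP => x; rewrite !ffunE.
  + rewrite /fits1 /= !eqxx /= H_toggles eqxx addrK eqxx !andbT.
    by apply/eqP/ffunP => x; rewrite !ffunE H_toggles.
  + rewrite /fits1 /= !eqxx /= andbT.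
    by apply/eqP/ffunP => x; rewrite !ffunE.
  + by rewrite /fits2 /= !eqxx /= H_toggles D1 eqxx.
  + by rewrite /fits2 /= !eqxx /= H_toggles eqxx.
  by rewrite /fits2 /= !eqxx.
- move=> i z w fr fr'; rewrite /fits_input; case: i => [[|k]|k] //.
  rewrite add0r /tile_transition /= idxE.
  suff E m : (m <= n)%N -> cst (u m) = None.
    have [mv _ _ /(_ (E n (leqnn n))) opE _] := uS n.
    rewrite clk_u eqxx in opE; move/eqP: opE => opE.
    by move: mv; rewrite !(E n (leqnn n)) opE !inE => /orP[] /eqP[] // ->.
  elim: m => [|m IHm] mn; first by rewrite u0.
  have Em := IHm (ltnW mn); have [mv _ _ /(_ Em) opE _] := uS m.
  rewrite clk_u in opE; move: mv; rewrite Em !inE => /orP[] /eqP[mE stE] //.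
  by move: opE; rewrite mE eqxx => /esym/eqP; lia.
- by move=> [[|k]|k] z w fr.
have small k (m : int) : (absz m < 2 ^ k)%N -> m != 0 -> D k m = false.
  move=> mk m0; rewrite /D dvdzE /=; apply/negP => /dvdn_leq.
  by rewrite absz_gt0 m0 => /(_ isT); rewrite leqNgt mk.
have ltpow k (m : int) : (absz m <= k)%N -> (absz m < 2 ^ k.+1)%N.
  by move=> mk; apply: leq_trans (ltn_expl k.+1 (ltnSn 1)); lia.
split=> m m0.
  (* A mark from time |m| on displays the multiples of 2^(k+1) with |m| < 2^(k+1): this set contains
     0 but not m. *)
  have [k mk opE] := marks true (absz m); exists k.+1%:Z => z.
  rewrite /visible /= /mark_kind !action_col /= opE eqxx /= D0 small //; last exact: ltpow.
  by have -> : (Mark true == Mark false) = false by [apply/eqP].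
have [k mk opE] := marks false (absz m); exists k.+1%:Z => w.
rewrite /visible /= /mark_kind !action_col /= opE eqxx /= D0 (small _ m) //; last exact: ltpow.
have -> : (Mark false == Mark true) = false by apply/eqP.
by [].
Qed.
End Complete.

(** * From three coordinates to all of Z^d *)

Section Space.
Variables (d' : nat) (chi : formula) (n : nat).
Hypothesis chi_ex : existential chi.
Local Notation d := d'.+3.
Local Notation vec := 'rV[int]_d.
Local Notation p0 := (body chi).
Local Notation e j := (delta_mx 0 j : vec).

Let j0 : 'I_d := @Ordinal d 0 isT.
Let j1 : 'I_d := @Ordinal d 1 isT.
Let j2 : 'I_d := @Ordinal d 2 isT.

Definition valid (y : vec -> tile p0) : Prop :=
  (forall (j : 'I_d) u, fits j (y u) (y (u + e j)))
  /\ forall u, fits_input (y u) (y (u + n.+1%:Z *: e j0)).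

Definition breaks (y : vec -> tile p0) : Prop :=
  forall p : vec, p <> 0 -> exists u, visible (y (u + p)) <> visible (y u).

Let at3 (i z w : int) : vec := \row_j nth 0 [:: i; z; w] j.

Let entry_add (u : vec) j k : (u + e j) 0 k = u 0 k + (k == j)%:R.
Proof. by rewrite !mxE. Qed.

Let at0 i z w k : at3 (i + k) z w = at3 i z w + k *: e j0.
Proof. by apply/rowP => -[[|[|[|j]]] lt_j]; rewrite !mxE /= ?mulr1 ?mulr0 ?addr0. Qed.

Let at1 i z w k : at3 i (z + k) w = at3 i z w + k *: e j1.
Proof. by apply/rowP => -[[|[|[|j]]] lt_j]; rewrite !mxE /= ?mulr1 ?mulr0 ?addr0. Qed.

Let at2 i z w k : at3 i z (w + k) = at3 i z w + k *: e j2.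
Proof. by apply/rowP => -[[|[|[|j]]] lt_j]; rewrite !mxE /= ?mulr1 ?mulr0 ?addr0. Qed.

Let const_line (T : Type) (f : vec -> T) j :
  (forall u, f (u + e j) = f u) -> forall u k, f (u + k *: e j) = f u.
Proof.
move=> fS u k; rewrite (int_const (f := fun k => f (u + k *: e j))).
  by rewrite scale0r addr0.
by move=> {}k; rewrite scalerDl scale1r addrA fS.
Qed.

Let const_plane (T : Type) (f : vec -> T) :
  (forall (j : 'I_d) u, (2 < j)%N -> f (u + e j) = f u) ->
  forall u, f u = f (at3 (u 0 j0) (u 0 j1) (u 0 j2)).
Proof.
move=> fS u; set v := at3 _ _ _.
rewrite -[in LHS](subrK v u) addrC [u - v]row_sum_delta.
elim: index_enum => [|j r IHr]; first by rewrite big_nil addr0.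
rewrite big_cons [X in v + X]addrC addrA; case: (ltnP 2 j) => j3.
  by rewrite const_line // => t; apply: fS.
rewrite (_ : (u - v) 0 j = 0) ?scale0r ?addr0 //.
by apply/eqP; rewrite !mxE subr_eq0; case: j j3 => -[|[|[|j]]] lt_j //= _;
  apply/eqP; congr (u 0 _); apply: val_inj.
Qed.

(** Apart from the free bit, a cell depends only on its first three coordinates, so a slice carries
    the argument. Along coordinates 1 and 2 the free bit is constant, so a break there is a break of
    the second visible component. *)
Lemma space_sound y : valid y -> breaks y -> exists G, forall k, holds G [:: n; k] chi.
Proof.
move=> [y_fits y_input] y_breaks; pose c i z w := y (at3 i z w).
have fits_e i z w (j : 'I_d) : fits j (c i z w) (y (at3 i z w + e j)) by exact: y_fits.
have vis3 u : (visible (y u)).2 = (visible (c (u 0 j0) (u 0 j1) (u 0 j2))).2.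
  suff E : unfree (y u) = unfree (c (u 0 j0) (u 0 j1) (u 0 j2)).
    by have /(congr1 (fun a => (visible a).2)) := E.
  apply: (const_plane (f := fun u => unfree (y u))) => j t j3; apply/esym/eqP.
  by have := y_fits j t; case: j j3 => -[|[|[|j]]].
have free_const (j : 'I_d) : (0 < j < 3)%N -> forall k u,
    free (y (u + k *: e j)) = free (y u).
  move=> j3 k u; apply: (const_line (f := fun u => free (y u))) => {}u.
  have := y_fits j u; case: j j3 => -[|[|[|j]]] //= lt_j _.
    by case/and5P=> _ _ _ _ /andP[/eqP ->].
  by case/and4P=> _ _ /eqP[_ _ ->].
have break (j : 'I_d) k : (0 < j < 3)%N -> k != 0 ->
    exists u, (visible (y (u + k *: e j))).2 <> (visible (y u)).2.
  move=> j3 k0; have [u] : exists u, visible (y (u + k *: e j)) <> visible (y u).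
    apply: y_breaks => /rowP/(_ j); rewrite !mxE !eqxx mulr1 => kE.
    by rewrite kE eqxx in k0.
  move=> ne; exists u => E; apply: ne.
  by rewrite [LHS]surjective_pairing E {1}/visible /= free_const // -surjective_pairing.
apply: (@tiling_sound chi n chi_ex c).
- by move=> i z w; rewrite {2}/c at0 scale1r; exact: fits_e j0.
- by move=> i z w; rewrite {2}/c at1 scale1r; exact: fits_e j1.
- by move=> i z w; rewrite {2}/c at2 scale1r; exact: fits_e j2.
- by move=> i z w; have := y_input (at3 i z w); rewrite -at0.
- have [||u] := break j1 1; rewrite ?oner_eq0 //;
  rewrite (vis3 (u + _)) (vis3 u) => ne; exists (u 0 j0), (u 0 j1), (u 0 j2).
  by move: ne; rewrite !mxE /= !mulr0 !addr0 mulr1.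
move=> k k0; have [||u] := break j2 k%:Z => //; first by rewrite -lt0n.
rewrite (vis3 (u + _)) (vis3 u) => ne; exists (u 0 j0), (u 0 j1), (u 0 j2).
by move: ne; rewrite !mxE /= !mulr0 !addr0 mulr1.
Qed.

Lemma space_complete G : (forall k, holds G [:: n; k] chi) ->
  exists2 y, valid y & breaks y.
Proof.
move=> /(tiling_complete chi_ex)[col [col0 col12 col_input col_free [col_b2 col_b1]]].
(* The indicator of the plane spanned by coordinates 1 and 2: a vector outside this plane moves 0
   out of it and is broken at 0. *)
pose fr (u : vec) : bool := [forall j : 'I_d, (0 < j < 3)%N || (u 0 j == 0)].
pose y (u : vec) := col (u 0 j0) (u 0 j1) (u 0 j2) (fr u).
have frE (j : 'I_d) k u : (0 < j < 3)%N -> fr (u + k *: e j) = fr u.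
  move=> j3; apply: eq_forallb => i; rewrite !mxE eqxx /=.
  by have [->|_] := eqVneq i j; rewrite ?j3 // mulr0 addr0.
exists y; first split.
- move=> j u; rewrite /y !entry_add; have := frE j 1 u; rewrite scale1r.
  case: j => -[|[|[|j]]] lt_j frj; rewrite /= -?val_eqE /= ?addr0.
  + exact: col0.
  + by rewrite frj //; have /andP[] := col12 (u 0 j0) (u 0 j1) (u 0 j2) (fr u).
  + by rewrite frj //; have /andP[] := col12 (u 0 j0) (u 0 j1) (u 0 j2) (fr u).
  by rewrite /fits_rest; apply/eqP; rewrite (col_free _ _ _ _).2 [RHS](col_free _ _ _ _).2.
- move=> u; rewrite /y !mxE /= !mulr0 !addr0 mulr1; exact: col_input.
move=> p p0; have [frp|frp] := boolP (fr p); last first.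
  exists 0; rewrite add0r /visible /= !(col_free _ _ _ _).1 => -[E _].
  rewrite E in frp; case/negP: frp; apply/forallP => j.
  by rewrite mxE eqxx orbT.
have p_out (j : 'I_d) : ~~ (0 < j < 3)%N -> p 0 j = 0.
  by move=> /negPf j3; have := forallP frp j; rewrite j3 => /eqP.
have vis i z w f : (visible (col i z w f)).2 = (visible (col i z w false)).2.
  by have [_ /(congr1 (fun a => (visible a).2))] := col_free i z w f.
have [p2|p2] := eqVneq (p 0 j2) 0; last first.
  have [i ne] := col_b2 _ p2; exists (at3 i 0 0) => /(congr1 snd).
  rewrite vis [RHS]vis !mxE /= add0r (p_out j0) // addr0 add0r; exact: ne.
have p1 : p 0 j1 != 0.
  apply/eqP => p1; apply: p0; apply/rowP => j; rewrite mxE.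
  have [j3|] := boolP (0 < j < 3)%N; last exact: p_out.
  have [jE|jE] : j = j1 \/ j = j2; try by rewrite jE.
  by case: j j3 => -[|[|[|j]]] // lt_j _; [left|right]; apply: val_inj.
have [i ne] := col_b1 _ p1; exists (at3 i 0 0) => /(congr1 snd).
by rewrite vis [RHS]vis !mxE /= !add0r (p_out j0) // addr0; exact: ne.
Qed.

End Space.

(** * Computability of the reduction *)

Local Close Scope ring_scope.

Lemma recursive_nth k i : i < k -> recursive (fun v : k.-tuple nat => nth 0 v i).
Proof.
by move=> ik; apply: (@recursive_proj k (Ordinal ik)) => v; rewrite (tnth_nth 0).
Qed.

Lemma recursive_ext k (f g : k.-tuple nat -> nat) : f =1 g -> recursive f -> recursive g.
Proof.
move=> fg rf; apply: (recursive_comp (h := fun i v => tnth v i) rf) => [i|v].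
  exact: recursive_proj.
by rewrite -fg; congr f; apply: eq_from_tnth => i; rewrite tnth_mktuple.
Qed.

Lemma recursive1 (g : nat -> nat) : recursive (fun w : 1.-tuple nat => g (nth 0 w 0)) ->
  forall k (a : k.-tuple nat -> nat), recursive a -> recursive (fun v => g (a v)).
Proof.
move=> rg k a ra; apply: (recursive_comp (h := fun=> a) rg) => // v.
by rewrite (nth_mktuple _ _ (@ord0 0)).
Qed.

Lemma recursive2 (g : nat -> nat -> nat) :
  recursive (fun w : 2.-tuple nat => g (nth 0 w 0) (nth 0 w 1)) ->
  forall k (a b : k.-tuple nat -> nat), recursive a -> recursive b ->
  recursive (fun v => g (a v) (b v)).
Proof.
move=> rg k a b ra rb.
apply: (recursive_comp (h := fun i : 'I_2 => if i == ord0 then a else b) rg) => [i|v].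
  by case: ifP.
by rewrite (nth_mktuple _ _ (@ord0 1)) (nth_mktuple _ _ (@Ordinal 2 1 isT)).
Qed.

Lemma recursive_S k (a : k.-tuple nat -> nat) : recursive a -> recursive (fun v => (a v).+1).
Proof.
by apply: (recursive1 (g := S)); apply: recursive_succ => v; rewrite /thead (tnth_nth 0).
Qed.

Lemma recursive_const k c : recursive (fun _ : k.-tuple nat => c).
Proof. by elim: c => [|c]; [exact: recursive_zero|exact: recursive_S]. Qed.

Lemma recursive_add k (a b : k.-tuple nat -> nat) : recursive a -> recursive b ->
  recursive (fun v => a v + b v).
Proof.
apply: recursive2; apply: (recursive_prec (g := fun v : 1.-tuple nat => nth 0 v 0)
  (h := fun v : 3.-tuple nat => (nth 0 v 1).+1)) => //=.
- exact: recursive_nth.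
- by apply: recursive_S; exact: recursive_nth.
Qed.

Lemma recursive_mul k (a b : k.-tuple nat -> nat) : recursive a -> recursive b ->
  recursive (fun v => a v * b v).
Proof.
apply: recursive2; apply: (recursive_prec (g := fun v : 1.-tuple nat => 0)
  (h := fun v : 3.-tuple nat => nth 0 v 1 + nth 0 v 2)) => //=.
- exact: recursive_const.
- by apply: recursive_add; exact: recursive_nth.
by move=> n v; rewrite mulSn addnC.
Qed.

Lemma recursive_exp2 k (a : k.-tuple nat -> nat) : recursive a ->
  recursive (fun v => 2 ^ a v).
Proof.
apply: (recursive1 (g := expn 2)); apply: (recursive_prec (g := fun v : 0.-tuple nat => 1)
  (h := fun v : 2.-tuple nat => nth 0 v 1 + nth 0 v 1)) => //=.
- exact: recursive_const.
- by apply: recursive_add; exact: recursive_nth.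
by move=> n v; rewrite expnS mul2n addnn.
Qed.

Lemma recursive_double k (a : k.-tuple nat -> nat) : recursive a ->
  recursive (fun v => (a v).*2).
Proof.
apply: (recursive1 (g := double)); apply: (recursive_prec (g := fun v : 0.-tuple nat => 0)
  (h := fun v : 2.-tuple nat => (nth 0 v 1).+2)) => //=.
- exact: recursive_const.
by do 2!apply: recursive_S; exact: recursive_nth.
Qed.

Lemma computable_ext (f g : nat -> nat) : f =1 g -> computable f -> computable g.
Proof. by move=> fg; apply: recursive_ext => v. Qed.

(** The code of x :: s is 2^x (2 c + 1), where c is the code of s. The list has a fixed length and
    only its items vary with n. *)
Lemma computable_code (I : Type) (r : seq I) (F : I -> nat -> nat) :
  (forall i, computable (F i)) ->
  computable (fun n => CodeSeq.code [seq F i n | i <- r]).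
Proof.
move=> cF; elim: r => [|i r IHr]; first exact: recursive_const.
apply: recursive_mul; first by apply: recursive_exp2; exact: cF.
by apply: recursive_S; apply: recursive_double; exact: IHr.
Qed.

Lemma computable_code2 (f g : nat -> nat) : computable f -> computable g ->
  computable (fun n => CodeSeq.code [:: f n; g n]).
Proof.
move=> cf cg; apply: (@computable_code bool [:: true; false] (fun b => if b then f else g)).
by case.
Qed.

Lemma computable_const c : computable (fun=> c).
Proof. exact: recursive_const. Qed.

Local Open Scope ring_scope.

Section TwoCells.
Variables (d : nat) (S : finType).

Lemma two_cells_uniq (v : 'rV[int]_d) (a b : S) : v != 0 -> uniq (unzip1 [:: (0, a); (v, b)]).
Proof. by rewrite /= inE eq_sym andbT. Qed.

Definition two_cells (v : 'rV[int]_d) (v0 : v != 0) (a b : S) : pattern d S :=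
  Pattern (two_cells_uniq a b v0).

Lemma appears_two_cells v (v0 : v != 0) a b (x : configuration d S) :
  appears (two_cells v0 a b) x <-> exists u, x u = a /\ x (u + v) = b.
Proof.
split=> -[u uP]; exists u.
  by split; [rewrite -[u]addr0|]; apply: uP; rewrite !inE eqxx ?orbT.
by case: uP => xa xb j c; rewrite !inE => /orP[] /eqP[-> ->]; rewrite ?addr0.
Qed.

End TwoCells.

Lemma pickle_row (d : nat) (v : 'rV[int]_d) :
  pickle v = CodeSeq.code [seq CodeSeq.code [:: pickle x; pickle (v x.1 x.2)]
                          | x <- enum {: 'I_1 * 'I_d}].
Proof.
transitivity (CodeSeq.code (map pickle (codom (total_fun (mx_val v))))) => //.
by congr CodeSeq.code; rewrite /codom /image_mem -map_comp; apply: eq_map => -[i j].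
Qed.

Section Reduction.
Variables (d' : nat) (chi : formula).
Hypothesis chi_ex : existential chi.
Local Notation d := d'.+3.
Local Notation L := (tile (body chi)).

(* [None] stands for the far constraint that loads the input. *)
Definition direction (n : nat) (o : option 'I_d) : 'rV[int]_d :=
  if o is Some j then delta_mx 0 j else n.+1%:Z *: delta_mx 0 (@Ordinal d 0 isT).

Lemma direction_neq0 n o : direction n o != 0.
Proof.
apply/eqP; case: o => [j|] /rowP => [/(_ j)|/(_ (@Ordinal d 0 isT))]; rewrite !mxE !eqxx //.
Qed.

Definition fits_in (o : option 'I_d) : L -> L -> bool :=
  if o is Some j then fits j else @fits_input _.

(** The forbidden pairs of tiles are the same for all n; only the displacement between the two cells
    of a far pattern changes. *)
Definition conflicts : seq (option 'I_d * L * L) :=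
  [seq t <- enum {: option 'I_d * L * L} | ~~ fits_in t.1.1 t.1.2 t.2].

Definition rules (n : nat) : seq (pattern d 'I_#|{: L}|) :=
  [seq two_cells (direction_neq0 n t.1.1) (enum_rank t.1.2) (enum_rank t.2)
  | t <- conflicts].

Definition shown : {ffun 'I_#|{: L}| -> 'I_#|{: bool * bool}|} :=
  [ffun a => enum_rank (visible (enum_val a))].

Definition instance (n : nat) : sofic_input d := SoficInput shown (rules n).

Lemma SFT_rules n (x : configuration d 'I_#|{: L}|) :
  SFT (rules n) x <-> valid n (fun u => enum_val (x u)).
Proof.
split=> [xP|[xfits xinput] w].
  have ok o u : fits_in o (enum_val (x u)) (enum_val (x (u + direction n o))).
    apply/negPn/negP => bad; set t := (o, enum_val (x u), enum_val (x (u + direction n o))).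
    have tP : t \in conflicts by rewrite mem_filter bad mem_enum.
    apply: (xP _ (map_f _ tP)); apply/appears_two_cells; exists u.
    by rewrite !enum_valK.
  by split=> [j u|u]; [exact: (ok (Some j))|exact: (ok None)].
case/mapP=> -[[o a] b]; rewrite mem_filter /= => /andP[bad _] -> /appears_two_cells[u [xa xb]].
case/negP: bad; rewrite -[a]enum_rankK -xa -[b]enum_rankK -xb.
by case: o xb => [j|] xb; [exact: xfits|exact: xinput].
Qed.

Lemma instance_aperiodic n :
  has_aperiodic_configuration (instance n) <-> exists G, forall k, holds G [:: n; k] chi.
Proof.
split=> [[x [y /SFT_rules yv xE] xap]|[G /(space_complete d' chi_ex)[y yv yb]]].
  apply: (space_sound chi_ex yv) => p /xap[u ne]; exists u => E; apply: ne.
  by rewrite !xE !ffunE E.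
exists (fun u => shown (enum_rank (y u))).
  exists (fun u => enum_rank (y u)) => //; apply/SFT_rules.
  by case: yv => y1 y2; split=> [j u|u]; rewrite !enum_rankK.
move=> p /yb[u ne]; exists u; rewrite !ffunE !enum_rankK => E; apply: ne.
exact: enum_rank_inj E.
Qed.

(** Unfolding the numbering leaves constants everywhere except for the integer n + 1 in the
    displacement of the far patterns. *)
Lemma computable_instance : computable (fun n => pickle (instance n)).
Proof.
apply: (computable_code2 (f := fun=> pickle (#|{: L}|, #|{: bool * bool}|))
  (g := fun n => CodeSeq.code [:: pickle shown; pickle (rules n)])).
  exact: computable_const.
apply: computable_code2; first exact: computable_const.
apply: (@computable_ext (fun n => CodeSeq.code [seq pickle
    (two_cells (direction_neq0 n t.1.1) (enum_rank t.1.2) (enum_rank t.2)) | t <- conflicts])).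
  by move=> n; rewrite /rules [RHS]/pickle /= /pickle_seq -map_comp.
apply: computable_code => -[[o a] b].
apply: (computable_code2
  (f := fun=> CodeSeq.code [:: pickle (0 : 'rV[int]_d); pickle (enum_rank a)])
  (g := fun n => CodeSeq.code [:: pickle (direction n o); pickle (enum_rank b)])).
  exact: computable_const.
apply: computable_code2; last exact: computable_const.
apply: (computable_ext (fun n => esym (pickle_row (direction n o)))).
apply: computable_code => -[i j]; apply: computable_code2; first exact: computable_const.
case: o => [k|].
  exact: (computable_const (pickle ((delta_mx 0 k : 'rV[int]_d) i j))).
case: (eqVneq j (@Ordinal d 0 isT)) => [->|j0].
  (* A nonnegative integer is coded as the pair of an option holding it and an empty option; options
     are lists of length at most one, and 0 codes the empty list. *)
  apply: (@computable_ext (fun n => CodeSeq.code [:: CodeSeq.code [:: n.+1]; 0%N])).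
    by move=> n; rewrite /= !mxE [i]ord1 !eqxx mulr1.
  apply: computable_code2; last exact: computable_const.
  apply: (@computable_code unit [:: tt] (fun=> S)) => _.
  by apply: recursive_succ.
apply: (@computable_ext (fun=> pickle (0 : int))); last exact: computable_const.
by move=> n; rewrite /= !mxE (negPf j0) andbF mulr0.
Qed.

End Reduction.

Lemma aperiodic_domino_hard (d' : nat) (Q : nat -> Prop) :
  Sigma11 Q -> many_one_reducible Q (aperiodic_domino d'.+3).
Proof.
move=> /Sigma11_normal_form[chi chi_ex QE].
exists (fun n => pickle (instance d' chi n)); first exact: computable_instance.
move=> n; rewrite QE -(instance_aperiodic d' chi_ex); split=> [nP|[X]].
  by exists (instance d' chi n).
by move=> /(pcan_inj pickleK) ->.
Qed.

Local Close Scope ring_scope.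

(** * The problem is analytic *)

(* [list_at c i a] says that [a] is the item of index [i] of the list coded by
   [c]; in the defining formula it is read off an auxiliary oracle. *)
Definition list_at (c i a : nat) : Prop := onth (CodeSeq.decode c) i = Some a.

Section Structure.
Variables (d : nat) (el : nat -> nat -> nat -> Prop) (yy : nat -> nat -> Prop).

(** The list of matrix indices depends on d alone, so its code is a numeral in the defining
    formula. *)
Definition keys : nat := CodeSeq.code [seq pickle x | x <- enum {: 'I_1 * 'I_d}].

Definition is_one c a := el c 0 a /\ forall x, ~ el c 1 x.
Definition is_two c a b := el c 0 a /\ el c 1 b /\ forall x, ~ el c 2 x.

(* [z] codes the integer [p - q] *)
Definition is_diff z p q := exists m x,
  is_two z x 0 /\ is_one x m /\ p = q + m \/ is_two z 0 x /\ is_one x m /\ q = p + m.+1.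

Definition entry c i z := exists q k, el c i q /\ el keys i k /\ is_two q k z.

(** The first clause forces each item to be an integer attached to the index of the same rank, hence
    at most as many items as indices; the second forbids missing ones. *)
Definition is_vec c :=
  (forall i q, el c i q -> exists z p r, entry c i z /\ is_diff z p r)
  /\ (forall i k, el keys i k -> exists q, el c i q).

(** Integers are differences of natural numbers, so their addition is stated by moving the negative
    parts across the equation. *)
Definition is_sum u v w := forall i k, el keys i k ->
  exists z1 z2 z3, entry u i z1 /\ entry v i z2 /\ entry w i z3 /\
  exists p1 r1 p2 r2 p3 r3, is_diff z1 p1 r1 /\ is_diff z2 p2 r2 /\ is_diff z3 p3 r3
    /\ p1 + p2 + r3 = r1 + r2 + p3.

Definition is_map l s t :=
  (forall i q, el l i q -> i < s /\ exists b, is_two q i b /\ b < t)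
  /\ (forall i, i < s -> exists q, el l i q).

Definition is_image l a b := exists q, el l a q /\ is_two q a b.

Definition is_pattern w s :=
  (forall j q, el w j q -> exists v a, is_two q v a /\ is_vec v /\ a < s)
  /\ (forall j j' q q' v a a', el w j q -> el w j' q' -> is_two q v a -> is_two q' v a' -> j = j').

Definition is_config s := forall v, is_vec v ->
  exists a, yy v a /\ a < s /\ forall a', yy v a' -> a' = a.

Definition avoids F := forall i w u, el F i w -> is_vec u ->
  exists j q v a u', el w j q /\ is_two q v a /\ is_sum u v u' /\ is_vec u' /\ ~ yy u' a.

Definition is_aperiodic l := forall p, is_vec p -> p <> pickle (0%R : 'rV[int]_d) ->
  exists u u' a a' b b', is_vec u /\ is_vec u' /\ is_sum u p u' /\ yy u a /\ yy u' a' /\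
    is_image l a b /\ is_image l a' b' /\ b <> b'.

Definition is_positive n := exists k m s t l F,
  is_two n k m /\ is_two k s t /\ is_two m l F /\ is_map l s t /\
  (forall i w, el F i w -> is_pattern w s) /\ is_config s /\ avoids F /\ is_aperiodic l.

End Structure.

(** One oracle holds three predicates under the tags 0, 1 and 2: the graph of the powers of 2, list
    access, and the configuration. *)
Definition pow_slice (f : nat -> bool) a p : Prop := f (pr 0 (pr a p)).
Definition list_slice (f : nat -> bool) s i a : Prop := f (pr 1 (pr s (pr i a))).
Definition config_slice (f : nat -> bool) v a : Prop := f (pr 2 (pr v a)).

Definition pow_spec f := forall a p, pow_slice f a p <->
  a = 0 /\ p = 1 \/ exists a' p', a = a'.+1 /\ p = p' + p' /\ pow_slice f a' p'.

(** The code s of h :: t satisfies s = 2^h (2 t + 1), with t the code of the tail. As t < s, this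
    recursion has a single solution, [list_at]; the exponential, which is no term, comes from
    [pow_slice]. *)
Definition list_spec f := forall s i a, list_slice f s i a <->
  exists h t p, pow_slice f h p /\ s = p * (t + t).+1 /\
    (i = 0 /\ a = h \/ exists i', i = i'.+1 /\ list_slice f t i' a).

(** * The conditions on codes are arithmetical *)

Section Definability.
Implicit Types T : seq nat -> nat.

Lemma definable_list T1 T2 T3 : term_definable T1 -> term_definable T2 -> term_definable T3 ->
  definable false (fun f e => list_slice f (T1 e) (T2 e) (T3 e)).
Proof. by move=> *; rewrite /list_slice /pr; define. Qed.
#[local] Hint Extern 1 (definable _ _) => apply: definable_list; define_term : definable.

Lemma definable_config T1 T2 : term_definable T1 -> term_definable T2 ->
  definable false (fun f e => config_slice f (T1 e) (T2 e)).
Proof. by move=> *; rewrite /config_slice /pr; define. Qed.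
#[local] Hint Extern 1 (definable _ _) => apply: definable_config; define_term : definable.

Lemma definable_pow T1 T2 : term_definable T1 -> term_definable T2 ->
  definable false (fun f e => pow_slice f (T1 e) (T2 e)).
Proof. by move=> *; rewrite /pow_slice /pr; define. Qed.
#[local] Hint Extern 1 (definable _ _) => apply: definable_pow; define_term : definable.

Lemma definable_one T1 T2 : term_definable T1 -> term_definable T2 ->
  definable false (fun f e => is_one (list_slice f) (T1 e) (T2 e)).
Proof. by move=> *; rewrite /is_one; define. Qed.
#[local] Hint Extern 1 (definable _ _) => apply: definable_one; define_term : definable.

Lemma definable_two T1 T2 T3 : term_definable T1 -> term_definable T2 -> term_definable T3 ->
  definable false (fun f e => is_two (list_slice f) (T1 e) (T2 e) (T3 e)).
Proof. by move=> *; rewrite /is_two; define. Qed.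
#[local] Hint Extern 1 (definable _ _) => apply: definable_two; define_term : definable.

Lemma definable_diff T1 T2 T3 : term_definable T1 -> term_definable T2 -> term_definable T3 ->
  definable false (fun f e => is_diff (list_slice f) (T1 e) (T2 e) (T3 e)).
Proof. by move=> *; rewrite /is_diff; define. Qed.
#[local] Hint Extern 1 (definable _ _) => apply: definable_diff; define_term : definable.

Lemma definable_entry d T1 T2 T3 : term_definable T1 -> term_definable T2 -> term_definable T3 ->
  definable false (fun f e => entry d (list_slice f) (T1 e) (T2 e) (T3 e)).
Proof. by move=> *; rewrite /entry; define. Qed.
#[local] Hint Extern 1 (definable _ _) => apply: definable_entry; define_term : definable.

Lemma definable_image T1 T2 T3 : term_definable T1 -> term_definable T2 -> term_definable T3 ->
  definable false (fun f e => is_image (list_slice f) (T1 e) (T2 e) (T3 e)).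
Proof. by move=> *; rewrite /is_image; define. Qed.
#[local] Hint Extern 1 (definable _ _) => apply: definable_image; define_term : definable.

Lemma definable_vec d T : term_definable T ->
  definable false (fun f e => is_vec d (list_slice f) (T e)).
Proof. by move=> *; rewrite /is_vec; define. Qed.
#[local] Hint Extern 1 (definable _ _) => apply: definable_vec; define_term : definable.

Lemma definable_sum d T1 T2 T3 : term_definable T1 -> term_definable T2 -> term_definable T3 ->
  definable false (fun f e => is_sum d (list_slice f) (T1 e) (T2 e) (T3 e)).
Proof. by move=> *; rewrite /is_sum; define. Qed.
#[local] Hint Extern 1 (definable _ _) => apply: definable_sum; define_term : definable.

Lemma definable_positive d : definable false (fun f e =>
  pow_spec f /\ list_spec f /\ is_positive d (list_slice f) (config_slice f) (head 0 e)).
Proof.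
rewrite /pow_spec /list_spec /is_positive /is_map /is_pattern /is_config /avoids /is_aperiodic.
by define.
Qed.

End Definability.

Section Slices.
Variable f : nat -> bool.
Hypotheses (fpow : pow_spec f) (flist : list_spec f).

Lemma pow_sliceE a p : pow_slice f a p <-> p = 2 ^ a.
Proof.
elim: a p => [|a IHa] p; rewrite fpow; split.
- by case=> [[_ ->]|[a' [p' []]]].
- by left.
- by case=> [[]//|[a' [p' [[<-] [-> /IHa ->]]]]]; rewrite expnS mul2n addnn.
by move=> ->; right; exists a, (2 ^ a); rewrite expnS mul2n addnn; split=> //; split=> //; apply/IHa.
Qed.

Lemma list_sliceE : list_slice f = list_at.
Proof.
apply: functional_extensionality => s; elim/ltn_ind: s => s IHs.
apply: functional_extensionality => i; apply: functional_extensionality => a.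
apply: propositional_extensionality; rewrite flist /list_at; split.
  case=> h [t [p [/pow_sliceE -> [sE H]]]].
  have -> : CodeSeq.decode s = h :: CodeSeq.decode t.
    by apply: (can_inj CodeSeq.codeK); rewrite CodeSeq.decodeK /= CodeSeq.decodeK sE addnn.
  case: H => [[-> ->]//|[i' [-> H]]]; rewrite IHs // in H.
  by rewrite sE; have := expn_gt0 2 h; nia.
case sE : (CodeSeq.decode s) => [|h t'] sa; first by rewrite onth0n in sa.
have {}sE : s = 2 ^ h * (CodeSeq.code t' + CodeSeq.code t').+1.
  by rewrite -[s]CodeSeq.decodeK sE addnn.
exists h, (CodeSeq.code t'), (2 ^ h); split; first exact/pow_sliceE.
split=> //; case: i sa => [[->]|i sa]; [by left|right]; exists i; split=> //.
rewrite IHs /list_at ?CodeSeq.codeK // sE; have := expn_gt0 2 h; nia.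
Qed.

End Slices.

Lemma slices_exist (Y : nat -> nat -> Prop) : exists f,
  [/\ pow_spec f, list_spec f & config_slice f = Y].
Proof.
pose P k := (exists a, k = pr 0 (pr a (2 ^ a)))
  \/ (exists s i a, k = pr 1 (pr s (pr i a)) /\ list_at s i a)
  \/ (exists v a, k = pr 2 (pr v a) /\ Y v a).
have powE a p : pow_slice (fun k => to_bool (P k)) a p <-> p = 2 ^ a.
  split=> [/to_boolP[[a' /pr_inj[_ /pr_inj[-> ->]]]//|]|->].
    by case=> [[s [i [b [/pr_inj[]]]]]|[v [b [/pr_inj[]]]]].
  by apply/to_boolP; left; exists a.
have listE s i a : list_slice (fun k => to_bool (P k)) s i a <-> list_at s i a.
  split=> [/to_boolP[[a' /pr_inj[]]//|[]]|sia].
  - by move=> [s' [i' [a' [/pr_inj[_ /pr_inj[-> /pr_inj[-> ->]]]]]]].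
  - by case=> [v [b [/pr_inj[]]]].
  by apply/to_boolP; right; left; exists s, i, a.
exists (fun k => to_bool (P k)); split.
- move=> a p; rewrite powE; split=> [->|].
    case: a => [|a]; [by left|right]; exists a, (2 ^ a).
    by rewrite powE expnS mul2n addnn.
  by case=> [[-> ->]//|[a' [p' [-> [-> /powE ->]]]]]; rewrite expnS mul2n addnn.
- move=> s i a; rewrite listE /list_at; split.
    case sE : (CodeSeq.decode s) => [|h t'] sa; first by rewrite onth0n in sa.
    have {}sE : s = 2 ^ h * (CodeSeq.code t' + CodeSeq.code t').+1.
      by rewrite -[s]CodeSeq.decodeK sE addnn.
    exists h, (CodeSeq.code t'), (2 ^ h); rewrite powE; split=> //; split=> //.
    case: i sa => [[->]|i sa]; [by left|right]; exists i; split=> //.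
    by rewrite listE /list_at CodeSeq.codeK.
  case=> h [t [p [/powE -> [sE]]]].
  have -> : CodeSeq.decode s = h :: CodeSeq.decode t.
    by apply: (can_inj CodeSeq.codeK); rewrite CodeSeq.decodeK /= CodeSeq.decodeK sE addnn.
  by case=> [[-> ->]//|[i' [-> /listE]]].
apply: functional_extensionality => v; apply: functional_extensionality => a.
apply: propositional_extensionality; split=> [/to_boolP|Yva]; last first.
  by apply/to_boolP; right; right; exists v, a.
case=> [[a' /pr_inj[]]//|[[s [i [b [/pr_inj[]]]]]//|]].
by case=> [v' [b [/pr_inj[_ /pr_inj[-> ->]]]]].
Qed.

(** * Correctness of the conditions on codes *)

Lemma is_oneE c a : is_one list_at c a <-> c = CodeSeq.code [:: a].
Proof.
rewrite /is_one /list_at; split=> [[c0 c1]|->]; last by rewrite CodeSeq.codeK.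
rewrite -[c]CodeSeq.decodeK; move: c0 c1; case: (CodeSeq.decode c) => [|x [|y s]] //=.
  by case=> ->.
by move=> _ /(_ y).
Qed.

Lemma is_twoE c a b : is_two list_at c a b <-> c = CodeSeq.code [:: a; b].
Proof.
rewrite /is_two /list_at; split=> [[c0 [c1 c2]]|->]; last by rewrite CodeSeq.codeK.
rewrite -[c]CodeSeq.decodeK; move: c0 c1 c2.
case: (CodeSeq.decode c) => [|x [|y [|z s]]] //=; first by case=> -> [->].
by move=> _ _ /(_ z).
Qed.

Lemma code_inj : injective CodeSeq.code. Proof. exact: can_inj CodeSeq.codeK. Qed.

Lemma code2_inj a b a' b' :
  CodeSeq.code [:: a; b] = CodeSeq.code [:: a'; b'] -> a = a' /\ b = b'.
Proof. by move=> /code_inj[-> ->]. Qed.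

Lemma is_diffE z p q :
  is_diff list_at z p q <-> exists x : int, z = pickle x /\ (x = p%:Z - q%:Z)%R.
Proof.
split.
  case=> m [x []] [/is_twoE -> [/is_oneE -> ->]].
    by exists (Posz m); split=> //; lia.
  by exists (Negz m); split=> //; lia.
case=> -[m|m] [-> E]; exists m, (CodeSeq.code [:: m]); [left|right].
  by split; [exact/is_twoE|split; [exact/is_oneE|lia]].
by split; [exact/is_twoE|split; [exact/is_oneE|lia]].
Qed.

Lemma is_diff_pickle (x : int) : exists p q, is_diff list_at (pickle x) p q.
Proof.
by case: x => m; [exists m, 0|exists 0, m.+1]; apply/is_diffE; eexists; split=> //; lia.
Qed.

Section Vectors.
Variable d : nat.
Local Notation vec := 'rV[int]_d.
Local Notation ks := (enum {: 'I_1 * 'I_d}).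

Lemma list_at_keys i k :
  list_at (keys d) i k <-> exists2 x, onth ks i = Some x & k = pickle x.
Proof.
rewrite /list_at CodeSeq.codeK onth_map; split; last by case=> x -> ->.
by case: onth => // x [<-]; exists x.
Qed.

Lemma list_at_vec (v : vec) i q : list_at (pickle v) i q <->
  exists2 x, onth ks i = Some x & q = CodeSeq.code [:: pickle x; pickle (v x.1 x.2)].
Proof.
rewrite pickle_row /list_at CodeSeq.codeK onth_map; split; last by case=> x -> ->.
by case: onth => // x [<-]; exists x.
Qed.

Lemma entryE (v : vec) i z : entry d list_at (pickle v) i z <->
  exists2 x, onth ks i = Some x & z = pickle (v x.1 x.2).
Proof.
split=> [[q [k [/list_at_vec[x ix ->] [_ /is_twoE/code2_inj[_ <-]]]]]|[x ix ->]].
  by exists x.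
exists (CodeSeq.code [:: pickle x; pickle (v x.1 x.2)]), (pickle x).
by split; [apply/list_at_vec; exists x|split; [apply/list_at_keys; exists x|exact/is_twoE]].
Qed.

(** The integers attached to the indices are collected by choice into a vector; its code has the
    same item as [c] at every rank, hence equals [c]. *)
Lemma is_vecE c : is_vec d list_at c <-> exists v : vec, c = pickle v.
Proof.
split=> [[c1 c2]|[v ->]]; last first.
  split=> [i q /list_at_vec[x ix _]|i k /list_at_keys[x ix _]].
    have [p [r pr]] := is_diff_pickle (v x.1 x.2); exists (pickle (v x.1 x.2)), p, r.
    by split=> //; apply/entryE; exists x.
  by exists (CodeSeq.code [:: pickle x; pickle (v x.1 x.2)]); apply/list_at_vec; exists x.
have item x : exists y : int, forall i, onth ks i = Some x ->
    list_at c i (CodeSeq.code [:: pickle x; pickle y]).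
  have /onthP[i ix] : x \in ks by rewrite mem_enum.
  have [|q iq] := c2 i (pickle x); first by apply/list_at_keys; exists x.
  have [z [p [r [[q' [k [iq' [/list_at_keys[x' ix' ->] /is_twoE q'E]]]] /is_diffE[y [zE _]]]]]] := c1 i q iq.
  exists y => j jx; have <- : i = j.
    apply: (@onth_inj _ ks); [exact: enum_uniq| |by rewrite ix jx].
    by rewrite gtn_min -!onthTE jx.
  by move: ix'; rewrite ix => -[->]; rewrite -zE -q'E.
have [y yP] := choice _ item.
exists (\matrix_(i, j) y (i, j))%R; rewrite pickle_row -[c]CodeSeq.decodeK; congr CodeSeq.code.
apply: eq_from_onth => i; rewrite onth_map; case ix : (onth ks i) => [x|] /=.
  by rewrite mxE -surjective_pairing; exact: yP.
case E : (onth _ i) => [q|] //; have [z [p [r [[q' [k [_ [/list_at_keys[x ix' _]]]]]]]]] := c1 i q E.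
by rewrite ix in ix'.
Qed.

Lemma is_sumE (u v w : vec) :
  is_sum d list_at (pickle u) (pickle v) (pickle w) <-> (w = u + v)%R.
Proof.
split=> [sum|->].
  apply/rowP => j; have /onthP[i ix] : (ord0, j) \in ks by rewrite mem_enum.
  have /sum : list_at (keys d) i (pickle (ord0 : 'I_1, j)) by apply/list_at_keys; exists (ord0, j).
  case=> z1 [z2 [z3 [/entryE[x1 ix1 ->] [/entryE[x2 ix2 ->] [/entryE[x3 ix3 ->]]]]]].
  move: ix1 ix2 ix3; rewrite ix => -[<-] [<-] [<-] /=.
  case=> p1 [r1 [p2 [r2 [p3 [r3 [/is_diffE[y1 [E1 E1']] [/is_diffE[y2 [E2 E2']] [/is_diffE[y3 [E3 E3']] E]]]]]]]].
  rewrite mxE (pcan_inj pickleK E1) (pcan_inj pickleK E2) (pcan_inj pickleK E3); lia.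
move=> i k /list_at_keys[x ix _].
exists (pickle (u x.1 x.2)), (pickle (v x.1 x.2)), (pickle ((u + v)%R x.1 x.2)).
split; first by apply/entryE; exists x.
split; first by apply/entryE; exists x.
split; first by apply/entryE; exists x.
have [p1 [r1 H1]] := is_diff_pickle (u x.1 x.2); have [p2 [r2 H2]] := is_diff_pickle (v x.1 x.2).
have [p3 [r3 H3]] := is_diff_pickle ((u + v)%R x.1 x.2).
exists p1, r1, p2, r2, p3, r3; do !split=> //.
case/is_diffE: H1 => y1 [/(pcan_inj pickleK) E1 ?]; case/is_diffE: H2 => y2 [/(pcan_inj pickleK) E2 ?].
case/is_diffE: H3 => y3 [/(pcan_inj pickleK) E3 ?]; rewrite !mxE E1 E2 in E3; lia.
Qed.

End Vectors.

Lemma pickle_ffun (s t : nat) (l : {ffun 'I_s -> 'I_t}) :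
  pickle l = CodeSeq.code [seq CodeSeq.code [:: val x; val (l x)] | x <- enum 'I_s].
Proof.
transitivity (CodeSeq.code (map pickle (codom (total_fun (l : {dffun forall _ : 'I_s, 'I_t}))))) => //.
by congr CodeSeq.code; rewrite /codom /image_mem -map_comp; apply: eq_map => i.
Qed.

Lemma onth_enum_ord s i (x : 'I_s) : onth (enum 'I_s) i = Some x <-> i = x.
Proof.
split=> [ix|->].
  by rewrite -(@onth_nth _ x _ _ _ ix) nth_enum_ord // -(size_enum_ord s) -onthTE ix.
have /onthP[j jx] : x \in enum 'I_s by rewrite mem_enum.
have jE : j = x by rewrite -(@onth_nth _ x _ _ _ jx) nth_enum_ord // -(size_enum_ord s) -onthTE jx.
by rewrite -jE.
Qed.

Lemma list_at_ffun s t (l : {ffun 'I_s -> 'I_t}) i q : list_at (pickle l) i q <->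
  exists2 x : 'I_s, i = x & q = CodeSeq.code [:: val x; val (l x)].
Proof.
rewrite pickle_ffun /list_at CodeSeq.codeK onth_map; split.
  by case ix : onth => [x|] //= [<-]; exists x => //; apply/onth_enum_ord.
by case=> x /onth_enum_ord -> ->.
Qed.

Lemma is_mapE l s t : is_map list_at l s t <-> exists l' : {ffun 'I_s -> 'I_t}, l = pickle l'.
Proof.
split=> [[l1 l2]|[l' ->]]; last first.
  split=> [i q /list_at_ffun[x -> ->]|i i_s].
    split; first exact: ltn_ord.
    exists (val (l' x)); split; last exact: ltn_ord.
    exact/is_twoE.
  exists (CodeSeq.code [:: i; val (l' (Ordinal i_s))]); apply/list_at_ffun.
  by exists (Ordinal i_s).
have item (x : 'I_s) : exists y : 'I_t, list_at l x (CodeSeq.code [:: val x; val y]).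
  have [q xq] := l2 x (ltn_ord x); have [_ [b [/is_twoE qE bt]]] := l1 _ _ xq.
  by exists (Ordinal bt); rewrite -qE.
have [y yP] := choice _ item; exists [ffun x => y x].
rewrite -[l]CodeSeq.decodeK pickle_ffun; congr CodeSeq.code.
apply: eq_from_onth => i; rewrite onth_map; case: (ltnP i s) => i_s.
  have /onth_enum_ord -> : i = Ordinal i_s by [].
  by rewrite [LHS](yP (Ordinal i_s)) /= ffunE.
rewrite [onth (enum _) i]onth_default ?size_enum_ord //=.
by case E : (onth _ i) => [q|] //; have [] := l1 _ _ E; rewrite ltnNge i_s.
Qed.

Lemma is_imageE s t (l : {ffun 'I_s -> 'I_t}) a b :
  is_image list_at (pickle l) a b <-> exists2 x : 'I_s, a = x & b = l x.
Proof.
split=> [[q [/list_at_ffun[x -> ->] /is_twoE/code2_inj[_ <-]]]|[x -> ->]]; first by exists x.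
exists (CodeSeq.code [:: val x; val (l x)]); split; last exact/is_twoE.
by apply/list_at_ffun; exists x.
Qed.

Lemma list_at_seq (T : countType) (s : seq T) i a :
  list_at (pickle s) i a <-> exists2 x, onth s i = Some x & a = pickle x.
Proof.
rewrite /list_at (_ : pickle s = CodeSeq.code (map pickle s)) // CodeSeq.codeK onth_map.
by split; [case: onth => // x [<-]; exists x|case=> x -> ->].
Qed.

Lemma pickle_seq_surj (T : countType) c :
  (forall i a, list_at c i a -> exists x : T, a = pickle x) -> exists s : seq T, c = pickle s.
Proof.
rewrite /list_at -[c]CodeSeq.decodeK; move: (CodeSeq.decode c) => r; rewrite CodeSeq.codeK => H.
suff [s ->] : exists s : seq T, r = map pickle s by exists s.
elim: r H => [|a r IHr] H; first by exists [::].
have [x ->] := H 0 a erefl; have [|s ->] := IHr; first by move=> i b; exact: (H i.+1).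
by exists (x :: s).
Qed.

Lemma is_patternE d s w : is_pattern d list_at w s <->
  exists w' : Defs.pattern d 'I_s, w = pickle w'.
Proof.
split=> [[w1 w2]|[w' ->]].
  have [|r wE] := @pickle_seq_surj ('rV[int]_d * 'I_s)%type w.
    move=> j q /w1[v [a [/is_twoE -> [/is_vecE[v' ->] a_s]]]].
    by exists (v', Ordinal a_s).
  suff r_uniq : uniq (unzip1 r) by exists (Pattern r_uniq).
  case: r wE => [|[v0 a0] r0] // wE; set r := _ :: r0 in wE *.
  apply/(uniqP v0) => i j; rewrite !inE size_map => ir jr.
  rewrite !(nth_map (v0, a0)) // => E; set x := nth _ r i in E; set y := nth _ r j in E.
  have at_nth k : k < size r -> list_at w k (pickle (nth (v0, a0) r k)).
    move=> kr; rewrite wE; apply/list_at_seq; exists (nth (v0, a0) r k) => //.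
    by rewrite onthE (nth_map (v0, a0)).
  apply: (w2 i j (pickle x) (pickle y) (pickle x.1) (pickle x.2) (pickle y.2)).
  - exact: at_nth.
  - exact: at_nth.
  - exact/is_twoE.
  by rewrite E; exact/is_twoE.
have wE : pickle w' = pickle (graph w') by [].
split=> [j q|j j' q q' v a a']; rewrite wE.
  case/list_at_seq=> -[v a] _ ->; exists (pickle v), (val a); split; first exact/is_twoE.
  by split; [apply/is_vecE; exists v|exact: ltn_ord].
move=> /list_at_seq[x jx ->] /list_at_seq[x' jx' ->] /is_twoE/code2_inj[xv _] /is_twoE/code2_inj[xv' _].
apply: (@onth_inj _ _ _ _ (graph_functional w')).
  by rewrite size_map gtn_min -!onthTE jx' .
by rewrite !onth_map jx jx' /=; congr Some; apply: (pcan_inj pickleK); rewrite xv xv'.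
Qed.

(** [yy] is the graph, on codes, of the source configuration; the projected one is expressed through
    the letter map and needs no witness of its own. *)
Lemma is_positiveE d n : (exists yy, is_positive d list_at yy n) <->
  exists2 X : sofic_input d, pickle X = n & has_aperiodic_configuration X.
Proof.
split=> [[yy]|[[s t l F] <- [x [y ySFT xE] xap]]]; last first.
  exists (fun v a => exists2 u : 'rV[int]_d, v = pickle u & a = val (y u)).
  exists (pickle (s, t)), (pickle (l, F)), s, t, (pickle l), (pickle F).
  split; first exact/is_twoE.
  split; first exact/is_twoE.
  split; first exact/is_twoE.
  split; first by apply/is_mapE; exists l.
  split; first by move=> i w /list_at_seq[w' _ ->]; apply/is_patternE; exists w'.
  split.
    move=> v /is_vecE[u ->]; exists (val (y u)); split; first by exists u.
    by split=> [|a [u' /(pcan_inj pickleK) <- ->]]; first exact: ltn_ord.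
  split.
    move=> i w v /list_at_seq[w' iw' ->] /is_vecE[u ->].
    have w'F : w' \in F by apply/onthP; exists i.
    apply: NNPP => no; apply: (ySFT _ w'F); exists u => j a ja.
    apply: NNPP => ya; apply: no; have /onthP[k kja] := ja.
    exists k, (pickle (j, a)), (pickle j), (val a), (pickle (u + j)%R).
    split; first by apply/(@list_at_seq _ (graph w')); exists (j, a).
    split; first exact/is_twoE.
    split; first exact/is_sumE.
    split; first by apply/is_vecE; exists (u + j)%R.
    by case=> u' /(pcan_inj pickleK) <- /val_inj E; apply: ya.
  move=> p /is_vecE[p' ->] p0; have [|u ne] := xap p'; first by move=> E; rewrite E in p0.
  exists (pickle u), (pickle (u + p')%R), (val (y u)), (val (y (u + p')%R)),
    (val (l (y u))), (val (l (y (u + p')%R))).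
  split; first by apply/is_vecE; exists u.
  split; first by apply/is_vecE; exists (u + p')%R.
  split; first exact/is_sumE.
  split; first by exists u.
  split; first by exists (u + p')%R.
  split; first by apply/is_imageE; exists (y u).
  split; first by apply/is_imageE; exists (y (u + p')%R).
  by move=> /val_inj E; apply: ne; rewrite !xE /= E.
case=> k [m [s [t [l [F [/is_twoE nE [/is_twoE kE [/is_twoE mE [/is_mapE[l' lE] [FP [yP [avoidP apP]]]]]]]]]]]].
have [F' FE] : exists F' : seq (Defs.pattern d 'I_s), F = pickle F'.
  by apply: pickle_seq_surj => i w /FP/is_patternE.
have [y yE] : exists y : 'rV[int]_d -> 'I_s, forall u a, yy (pickle u) a <-> a = y u.
  apply: (choice (fun u b => forall a, yy (pickle u) a <-> a = val b)) => u.
  have [|a [ya [a_s a1]]] := yP (pickle u); first by apply/is_vecE; exists u.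
  by exists (Ordinal a_s) => b; split=> [/a1|->].
exists (SoficInput l' F'); first by rewrite nE kE mE lE FE.
exists (fun u => l' (y u)).
  exists y => // w wF [u uP]; have /onthP[i iw] := wF.
  have [||j [q [v [a [u' [jq [/is_twoE qE [sumP [/is_vecE[u'' u'E] ne]]]]]]]]] :=
    avoidP i (pickle w) (pickle u).
  - by rewrite FE; apply/list_at_seq; exists w.
  - by apply/is_vecE; exists u.
  move: jq; rewrite (_ : pickle w = pickle (graph w)) // => /list_at_seq[[v' a'] jv qE'].
  have [vE aE] := code2_inj (etrans (esym qE) qE').
  rewrite u'E vE in sumP ne; move/is_sumE: sumP => sumE; apply: ne; apply/yE.
  rewrite aE; congr val; rewrite sumE; apply/esym; apply: uP.
  by apply/onthP; exists j.
move=> p p0; have [||u [u' [a [a' [b [b' [/is_vecE[v uE] [/is_vecE[v' u'E] [sumP [ya [ya' [im [im' ne]]]]]]]]]]]]] :=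
  apP (pickle p).
- by apply/is_vecE; exists p.
- by move=> /(pcan_inj pickleK).
rewrite uE u'E in sumP ya ya'; move/is_sumE: sumP => v'E.
move/yE: ya => aE; move/yE: ya' => a'E; rewrite lE in im im'.
case/is_imageE: im => z az bz; case/is_imageE: im' => z' az' bz'.
have zE : z = y v by apply: val_inj; rewrite /= -az.
have zE' : z' = y v' by apply: val_inj; rewrite /= -az'.
by exists v => E; apply: ne; rewrite bz bz' zE zE' v'E E.
Qed.

(** The recursions for powers and lists are imposed on the oracle as part of the relation. They fix
    these two slices completely, so only the configuration slice is really guessed. *)
Lemma aperiodic_domino_Sigma11 d : Sigma11 (aperiodic_domino d).
Proof.
have [phi _ phiE] := definable_positive d.
exists (fun f n => pow_spec f /\ list_spec f /\
  is_positive d (list_slice f) (config_slice f) n).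
  by exists phi => f n; rewrite phiE.
move=> n; rewrite /aperiodic_domino /coded_problem -is_positiveE; split.
  case=> yy yyP; have [f [fpow flist fyy]] := slices_exist yy; exists f.
  by rewrite (list_sliceE fpow flist) fyy.
case=> f [fpow [flist]]; rewrite (list_sliceE fpow flist) => fP.
by exists (config_slice f).
Qed.

Theorem theorem11 (d : nat) (hd : 3 <= d) : Sigma11_complete (aperiodic_domino d).
Proof.
split; first exact: aperiodic_domino_Sigma11.
by case: d hd => [|[|[|d']]] // _ Q; exact: aperiodic_domino_hard.
Qed.
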